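(* Let $n\ge1$, let $\{X^u\}_{u\in\mathbb{N}^n}$ be a one-critical, exhaustive $n$-parameter filtration of a cell complex $X$, let $\mathcal{V}$ be a discrete gradient vector field on $X$ consistent with the filtration, and let $\{M^u\}_{u\in\mathbb{N}^n}$ be the associated $n$-parameter filtration of the Morse complex $M$. Then, for all $q\in\mathbb{N}$, $$\bigcup_{i=0}^n\operatorname{supp}\xi_i^q\subseteq\overline{\mathcal{G}(M_{q+1})}\cup\overline{\mathcal{G}(M_q)}.$$ Furthermore, $\operatorname{supp}\xi_0^q\subseteq\overline{\mathcal{G}(M_q)}$ and $\operatorname{supp}\xi_n^q\subseteq\overline{\mathcal{G}(M_{q+1})}$ for all $q\in\mathbb{N}$. Here $\xi_i^q$ are the Betti tables of $V_q=\bigoplus_{u\in\mathbb{N}^n}H_q(X^u)$.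
   Context: $\mathbb{F}$ is a fixed field, $\mathbb{N}=\{0,1,\dots\}$, $e_1,\dots,e_n$ is the standard basis of $\mathbb{N}^n$, and $\preceq$ is the coordinatewise order on $\mathbb{N}^n$, with least upper bound $\bigvee$. A cell complex is a finite graded set $X=\bigsqcup_{q\in\mathbb{N}}X_q$ (elements of $X_q$ are $q$-cells) with an incidence function $\kappa:X\times X\to\mathbb{F}$ such that $\kappa(\tau,\sigma)\neq0$ implies $\dim\tau=\dim\sigma+1$, and $\sum_{\rho\in X}\kappa(\tau,\rho)\kappa(\rho,\sigma)=0$ for all $\tau,\sigma$. Write $\sigma<\tau$ if $\kappa(\tau,\sigma)\ne0$; the face partial order $\le$ on $X$ is generated by this relation. $C_*(X)$ is the chain complex with $C_q(X)$ the $\mathbb{F}$-vector space with basis $X_q$ and $\partial_q(\tau)=\sum_{\sigma\in X_{q-1}}\kappa(\tau,\sigma)\sigma$. A subcomplex is a subset closed under passing to faces, with the restricted incidence function. $H_q$ denotes homology. An $n$-parameter filtration of $X$ is a family of subcomplexes $\{X^u\}_{u\in\mathbb{N}^n}$ with $X^u\subseteq X^v$ for $u\preceq v$; one sets $X^w=\emptyset$ if $w\notin\mathbb{N}^n$. It is exhaustive if $X=\bigcup_uX^u$. A grade $u$ is an entrance grade of a cell $\sigma$ if $\sigma\in X^u\setminus\bigcup_{j=1}^nX^{u-e_j}$. The filtration is one-critical if $X^u=\{\sigma\in X\mid h(\sigma)\preceq u\}$ for some order-preserving $h:(X,\le)\to(\mathbb{N}^n,\preceq)$ (equivalently, every cell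 has exactly one entrance grade). $S=\mathbb{F}[x_1,\dots,x_n]$; $V_q$ is an $n$-graded $S$-module, with $x_i$ acting by the maps $H_q(X^u)\to H_q(X^{u+e_i})$ induced by inclusion. $\xi_i^q(u)=\dim_{\mathbb{F}}(\operatorname{Tor}_i^S(V_q,\mathbb{F}))^u$, where $\mathbb{F}=S/\langle x_1,\dots,x_n\rangle$; $\operatorname{supp}\xi_i^q=\{u\mid\xi_i^q(u)\neq0\}$. A discrete vector field $\mathcal{V}$ on $X$ is a set of pairs $(\sigma,\tau)\in X\times X$ with $\sigma<\tau$ such that every cell appears in at most one pair (in at most one position). It is a discrete gradient vector field if there is no sequence $(\sigma_0,\tau_0,\sigma_1,\tau_1,\dots,\sigma_{r-1},\tau_{r-1},\sigma_r)$ with $r\ge1$, $(\sigma_i,\tau_i)\in\mathcal{V}$, $\sigma_{i+1}<\tau_i$, $\sigma_{i+1}\ne\sigma_i$ for all $0\le i<r$, and $\sigma_r=\sigma_0$. It is consistent with the filtration if for all $(\sigma,\tau)\in\mathcal{V}$ and all $u$, $\sigma\in X^u$ if and only if $\tau\in X^u$. $M=\bigsqcup_qM_q$ is the set of critical cells, i.e. cells in no pair of $\mathcal{V}$, graded by dimension, and $M^u=M\cap X^u$. ($M$ also carries an incidence function making it a cell complex filtered by the $M^u$, but only the set of critical cells and their grades enter the statement.) For $\Gamma=M_q$, $\mathcal{G}(M_q)\subseteq\mathbb{N}^n$ is the set of entrance grades of the critical $q$-cells, and for $G\subseteq\mathbb{N}^n$, $\overline{G}=\{\bigvee L\mid L\subseteq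 G\text{ finite}, L\ne\emptyset\}$. *)

(* Defs.v *)
From HB Require Import structures.
From mathcomp Require Import all_boot all_order all_algebra.
From mathcomp.multinomials Require Import mpoly.

Set Implicit Arguments.
Unset Strict Implicit.
Unset Printing Implicit Defensive.

Import GRing.Theory.
Local Open Scope ring_scope.

(* A grade u in N^n is a multinomial u : 'X_{1..n}; the coordinatewise order  *)
(* is (u <= v)%MM (not the total monomial order <=%O), e_i is U_(i)%MM, and   *)
(* binary joins are mlcm.                                                     *)

Section Subquotient.
Variables (F : fieldType) (L : vectType F).
Implicit Types Z B : {vspace L}.

(* The vector space Z / (Z :&: B), i.e. Z / B when B <= Z, carried by a       *)
(* complement of Z :&: B in Z; cls is the class map and rep a linear section  *)
(* of it. Only the values of cls on Z are meaningful (see cls_eq0, repK).     *)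
Definition subquot Z B : vectType F := subvs_of (Z :\: B)%VS.

Definition cls Z B : 'Hom(L, subquot Z B) :=
  (linfun (vsproj (Z :\: B)) \o addv_pi1 Z B)%VF.

Definition rep Z B : 'Hom(subquot Z B, L) := linfun vsval.

Lemma rep_mem Z B h : rep Z B h \in Z.
Proof. by rewrite lfunE /=; apply: (subvP (diffvSl Z B)); apply: subvsP. Qed.

Lemma repK Z B h : cls Z B (rep Z B h) = h.
Proof.
apply: val_inj; rewrite /cls comp_lfunE !lfunE /= vsprojK ?memv_pi //.
by rewrite daddv_pi_id ?capv_diff //; apply: subvsP.
Qed.

Lemma rep_cls Z B x : x \in Z -> x - rep Z B (cls Z B x) \in B.
Proof.
move=> xZ; rewrite /cls comp_lfunE !lfunE /= vsprojK ?memv_pi //.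
have xZB : x \in (Z + B)%VS by apply: (subvP (addvSl Z B)).
by rewrite -{1}(addv_pi1_pi2 xZB) addrC addKr memv_pi.
Qed.

Lemma cls_eq0 Z B x : x \in Z -> (cls Z B x == 0) = (x \in B).
Proof.
move=> xZ; apply/eqP/idP => [cx0 | xB].
  by have := rep_cls B xZ; rewrite cx0 linear0 subr0.
have repB : rep Z B (cls Z B x) \in B.
  by rewrite -(subKr x (rep _ _ _)) rpredB // rep_cls.
have : rep Z B (cls Z B x) \in ((Z :\: B) :&: B)%VS.
  by rewrite memv_cap repB andbT lfunE; apply: subvsP.
rewrite capv_diff memv0 => /eqP r0.
by rewrite -[cls Z B x]repK r0 linear0.
Qed.

End Subquotient.

Section GradedModules.
Variables (F : fieldType) (n : nat).
Local Notation grade := 'X_{1..n}.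

(* An n-graded module over F[x_1,...,x_n] with finite-dimensional homogeneous *)
(* components: for (u <= v)%MM, gact u v : V^u -> V^v is the action of the    *)
(* monomial x^(v - u); it carries no information for other u, v.              *)
Record gmodule := GModule {
  gcomp :> grade -> vectType F;
  gact : forall u v, 'Hom(gcomp u, gcomp v);
  gact_id : forall u, gact u u = \1%VF;
  gact_comp : forall u v w, (u <= v)%MM -> (v <= w)%MM ->
    (gact v w \o gact u v)%VF = gact u w }.

Record ghom (V W : gmodule) := GHom {
  ghom_fun :> forall u, 'Hom(V u, W u);
  ghom_act : forall u v, (u <= v)%MM ->
    (ghom_fun v \o gact V u v)%VF = (gact W u v \o ghom_fun u)%VF }.

Definition below (u : grade) : seq grade :=
  [seq g <- [seq bmnm m | m : 'X_{1..n < (mdeg u).+1}] | (g <= u)%MM].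

Lemma mem_below u g : (g \in below u) = (g <= u)%MM.
Proof.
rewrite mem_filter; case: (boolP (g <= u)%MM) => //= gu.
have gd : (mdeg g < (mdeg u).+1)%N.
  by rewrite ltnS !mdegE; apply: leq_sum => i _; exact: (mnm_lepP gu).
by apply/imageP; exists (BMultinom gd).
Qed.

Lemma below_uniq u : uniq (below u).
Proof.
by rewrite filter_uniq // map_inj_in_uniq ?enum_uniq // => x y _ _; exact: val_inj.
Qed.

(* P is free over F[x_1,...,x_n] on a homogeneous basis, gen g listing the    *)
(* basis elements of degree g: the multiples x^(u - g) * b, with b in gen g   *)
(* and (g <= u)%MM, form an F-basis of P^u.                                   *)
Definition gfree (P : gmodule) : Prop :=
  exists gen : forall g, seq (P g),
    forall u, basis_of {:P u} [seq gact P g u b | g <- below u, b <- gen g].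

Record free_resolution (V : gmodule) := FreeResolution {
  res :> nat -> gmodule;
  res_d : forall i, ghom (res i.+1) (res i);
  res_aug : ghom (res 0) V;
  res_free : forall i, gfree (res i);
  res_aug_surj : forall u, limg (res_aug u) = fullv;
  res_exact0 : forall u, limg (res_d 0 u) = lker (res_aug u);
  res_exact : forall i u, limg (res_d i.+1 u) = lker (res_d i u) }.

Definition irrelevant_part (P : gmodule) (u : grade) : {vspace P u} :=
  (\sum_(i < n | (U_(i) <= u)%MM) limg (gact P (u - U_(i))%MM u))%VS.

(* The degree u component of P (x)_S S/<x_1,...,x_n> = P / <x_1,...,x_n> P.   *)
Definition tensF (P : gmodule) (u : grade) : vectType F :=
  subquot fullv (irrelevant_part P u).

Definition tensF_hom (P Q : gmodule) (f : ghom P Q) (u : grade) :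
    'Hom(tensF P u, tensF Q u) :=
  (cls fullv (irrelevant_part Q u) \o f u \o rep fullv (irrelevant_part P u))%VF.

Definition Tor_cycles (V : gmodule) (R : free_resolution V) (i : nat) (u : grade)
    : {vspace tensF (R i) u} :=
  match i with
  | 0 => fullv
  | j.+1 => lker (tensF_hom (res_d R j) u)
  end.

(* The degree u component of Tor_i(V, F), computed from R.                    *)
Definition Tor (V : gmodule) (R : free_resolution V) (i : nat) (u : grade)
    : vectType F :=
  subquot (Tor_cycles R i u) (limg (tensF_hom (res_d R i) u)).

(* The standard free resolution: S (x)_F W -> W is a free cover of W, whose   *)
(* degree u component is the direct sum of the W^g for (g <= u)%MM; it is     *)
(* iterated on kernels.                                                       *)

Section Cover.
Variable W : gmodule.

Definition cover_idx (u : grade) : finType :=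
  {g : seq_sub (below u) & 'I_(\dim {:W (ssval g)})}.

Definition cover_key u (t : cover_idx u) : {g : grade & 'I_(\dim {:W g})} :=
  Tagged (fun g => 'I_(\dim {:W g})) (tagged t).

Lemma cover_key_inj u : injective (@cover_key u).
Proof.
move=> [[g gu] k] [[g' gu'] k'] /= E.
have Eg : g = g' := congr1 tag E.
subst g'; rewrite /cover_key /= in E.
have /= Ek : k = k' by apply/eqP; move/eqP: E; rewrite eq_Tagged.
by rewrite Ek (bool_irrelevance gu gu').
Qed.

Lemma cover_keyP u (x : {g : grade & 'I_(\dim {:W g})}) :
  (tag x <= u)%MM -> {t : cover_idx u | cover_key t = x}.
Proof.
case: x => g k /= gu.
have gb : g \in below u by rewrite mem_below.
by exists (Tagged (fun g : seq_sub (below u) => 'I_(\dim {:W (ssval g)}))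
             (k : 'I_(\dim {:W (ssval (SeqSub gb))}))).
Qed.

Lemma cover_key_le u (t : cover_idx u) : (tag (cover_key t) <= u)%MM.
Proof. by rewrite -mem_below; exact: (ssvalP (tag t)). Qed.

Definition cover_comp u : vectType F := {ffun cover_idx u -> F^o}.

Definition cover_act_fun u v (c : cover_comp u) : cover_comp v :=
  [ffun t => \sum_(s | cover_key s == cover_key t) c s].

Fact cover_act_linear u v : linear (@cover_act_fun u v).
Proof.
move=> a c c'; apply/ffunP=> t; rewrite !ffunE scaler_sumr -big_split /=.
by apply: eq_bigr => s _; rewrite !ffunE.
Qed.
HB.instance Definition _ u v := GRing.isLinear.Build F (cover_comp u)
  (cover_comp v) _ (@cover_act_fun u v) (@cover_act_linear u v).

Definition cover_aug_fun u (c : cover_comp u) : W u :=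
  \sum_(t : cover_idx u)
     c t *: gact W (tag (cover_key t)) u (vbasis fullv)`_(tagged (cover_key t)).

Fact cover_aug_linear u : linear (@cover_aug_fun u).
Proof.
move=> a c c'; rewrite scaler_sumr -big_split /=.
by apply: eq_bigr => s _; rewrite !ffunE scalerDl scalerA.
Qed.
HB.instance Definition _ u := GRing.isLinear.Build F (cover_comp u)
  (W u) _ (@cover_aug_fun u) (@cover_aug_linear u).

Definition cover_act u v : 'Hom(cover_comp u, cover_comp v) :=
  linfun (@cover_act_fun u v).

Lemma cover_actE u v c t s : cover_key s = cover_key t ->
  cover_act u v c t = c s.
Proof.
move=> E; rewrite lfunE /= ffunE (big_pred1 s) // => s' /=.
by rewrite -E (inj_eq (@cover_key_inj u)).
Qed.

Lemma cover_act0 u v c t : ~~ (tag (cover_key t) <= u)%MM ->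
  cover_act u v c t = 0.
Proof.
move=> N; rewrite lfunE /= ffunE big1 // => s /eqP E.
by case/negP: N; rewrite -E cover_key_le.
Qed.

Fact cover_act_id u : cover_act u u = \1%VF.
Proof.
by apply/lfunP=> c; apply/ffunP=> t; rewrite id_lfunE (cover_actE _ (erefl _)).
Qed.

Fact cover_act_comp u v w : (u <= v)%MM -> (v <= w)%MM ->
  (cover_act v w \o cover_act u v)%VF = cover_act u w.
Proof.
move=> uv vw; apply/lfunP=> c; apply/ffunP=> t; rewrite comp_lfunE.
case: (boolP (tag (cover_key t) <= u)%MM) => tu.
  have [s Es] := cover_keyP tu.
  have [s' Es'] := cover_keyP (lepm_trans tu uv).
  by rewrite (cover_actE _ Es') (cover_actE _ (etrans Es (esym Es')))
             (cover_actE _ Es).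
rewrite [RHS]cover_act0 //.
case: (boolP (tag (cover_key t) <= v)%MM) => tv; last by rewrite cover_act0.
have [s' Es'] := cover_keyP tv.
by rewrite (cover_actE _ Es') cover_act0 // Es'.
Qed.

Definition cover : gmodule := GModule cover_act_id cover_act_comp.

Definition cover_delta u (t : cover_idx u) : cover_comp u :=
  [ffun s => (s == t)%:R : F^o].

Lemma cover_act_delta u v (s : cover_idx u) (t : cover_idx v) :
  cover_key s = cover_key t -> cover_act u v (cover_delta s) = cover_delta t.
Proof.
move=> E; apply/ffunP=> t'; rewrite [RHS]ffunE.
case: (boolP (tag (cover_key t') <= u)%MM) => tu.
  have [s' Es'] := cover_keyP tu.
  rewrite (cover_actE _ Es') ffunE -(inj_eq (@cover_key_inj u)) Es' E.
  by rewrite (inj_eq (@cover_key_inj v)).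
rewrite cover_act0 //; case: eqP => // Et; case/negP: tu.
by rewrite Et -E cover_key_le.
Qed.

Lemma cover_aug_delta u (t : cover_idx u) :
  linfun (@cover_aug_fun u) (cover_delta t) =
  gact W (tag (cover_key t)) u (vbasis fullv)`_(tagged (cover_key t)).
Proof.
rewrite lfunE /= /cover_aug_fun (bigD1 t) //= ffunE eqxx scale1r.
by rewrite big1 ?addr0 // => s /negPf nst; rewrite ffunE nst scale0r.
Qed.

Lemma cover_decomp u (c : cover_comp u) :
  c = \sum_t c t *: cover_delta t.
Proof.
apply/ffunP=> s; rewrite sum_ffunE (bigD1 s) //= !ffunE eqxx.
rewrite [X in _ + X]big1 ?addr0; first by rewrite /GRing.scale /= mulr1.
move=> t /negPf nts; rewrite !ffunE eq_sym nts; exact: mulr0.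
Qed.

Lemma cover_hom_ext u (T : vectType F) (f g : 'Hom(cover_comp u, T)) :
  (forall t, f (cover_delta t) = g (cover_delta t)) -> f = g.
Proof.
move=> E; apply/lfunP=> c; rewrite (cover_decomp c) !linear_sum.
by apply: eq_bigr => t _; rewrite !linearZ /= E.
Qed.

Fact cover_aug_act u v : (u <= v)%MM ->
  (linfun (@cover_aug_fun v) \o gact cover u v)%VF =
  (gact W u v \o linfun (@cover_aug_fun u))%VF.
Proof.
move=> uv; apply: cover_hom_ext => s; rewrite !comp_lfunE.
have [t Et] := cover_keyP (lepm_trans (cover_key_le s) uv).
rewrite /= (cover_act_delta (esym Et)) !cover_aug_delta Et.
by rewrite -comp_lfunE gact_comp // cover_key_le.
Qed.

Definition cover_aug : ghom cover W := GHom cover_aug_act.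

Lemma cover_aug_surj u : limg (cover_aug u) = fullv.
Proof.
apply/eqP; rewrite eqEsubv subvf /=; apply/subvP=> x _.
rewrite (coord_vbasis (memvf x)); apply: memv_suml => k _; apply: memvZ.
have [t Et] := @cover_keyP u (Tagged (fun g => 'I_(\dim {:W g})) k) (lepm_refl u).
have <- : cover_aug u (cover_delta t) = (vbasis fullv)`_k.
  by rewrite /= cover_aug_delta Et /= gact_id id_lfunE.
exact: memv_img (memvf _).
Qed.

Fact cover_free : gfree cover.
Proof.
have kP g (k : 'I_(\dim {:W g})) : {t : cover_idx g |
    cover_key t = Tagged (fun g => 'I_(\dim {:W g})) k}.
  by apply: cover_keyP; exact: lepm_refl.
pose gen g : seq (cover g) := [seq cover_delta (sval (kP g k)) | k : 'I_(\dim {:W g})].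
exists gen => u; rewrite basisEdim; apply/andP; split.
  apply/subvP=> c _; rewrite (cover_decomp c); apply: memv_suml => t _.
  apply/memvZ/memv_span; pose g := tag (cover_key t); pose k := tagged (cover_key t).
  apply/allpairsPdep; exists g, (cover_delta (sval (kP g k))).
  split; first by rewrite mem_below cover_key_le.
    exact: image_f.
  rewrite /= (@cover_act_delta _ _ _ t) //.
  by case: (kP g k) => /= t0 ->; rewrite /g /k; case: (cover_key t).
have -> : \dim {:cover u} = #|cover_idx u|.
  by rewrite dimvf -[RHS]muln1.
rewrite size_allpairs_dep card_tagged.
have E : below u = [seq ssval i | i <- enum {: seq_sub (below u)}].
  by rewrite enumT unlock val_seq_sub_enum ?below_uniq.
rewrite [X in (sumn X <= _)%N](_ : _ =
    [seq size (gen (ssval i)) | i <- enum {: seq_sub (below u)}]); last first.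
  by rewrite [in LHS]E -map_comp.
apply: eq_leq; congr sumn; apply: eq_map => g /=.
by rewrite size_map -cardE card_ord.
Qed.

End Cover.

Section Kernel.
Variables (V W : gmodule) (f : ghom V W).

Definition gker_comp u : vectType F := subvs_of (lker (f u)).

Definition gker_act u v : 'Hom(gker_comp u, gker_comp v) :=
  (linfun (vsproj (lker (f v))) \o gact V u v \o linfun vsval)%VF.

Lemma gker_actE u v x : (u <= v)%MM ->
  vsval (gker_act u v x) = gact V u v (vsval x).
Proof.
move=> uv; rewrite !comp_lfunE !lfunE /= vsprojK // memv_ker.
rewrite -comp_lfunE ghom_act // comp_lfunE.
have := subvsP x; rewrite memv_ker => /eqP ->.
by rewrite linear0.
Qed.

Fact gker_act_id u : gker_act u u = \1%VF.
Proof.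
apply/lfunP=> x; apply: val_inj.
by rewrite [LHS]gker_actE ?lepm_refl // gact_id !id_lfunE.
Qed.

Fact gker_act_comp u v w : (u <= v)%MM -> (v <= w)%MM ->
  (gker_act v w \o gker_act u v)%VF = gker_act u w.
Proof.
move=> uv vw; apply/lfunP=> x; apply: val_inj.
rewrite comp_lfunE [LHS]gker_actE // [X in gact _ _ _ X]gker_actE //.
by rewrite [RHS]gker_actE ?(lepm_trans uv vw) // -comp_lfunE gact_comp.
Qed.

Definition gker : gmodule := GModule gker_act_id gker_act_comp.

Fact gker_incl_act u v : (u <= v)%MM ->
  ((linfun vsval : 'Hom(gker v, V v)) \o gact gker u v)%VF =
  (gact V u v \o linfun vsval)%VF.
Proof.
move=> uv; apply/lfunP=> x; rewrite [LHS]comp_lfunE [RHS]comp_lfunE [LHS]lfunE [LHS]gker_actE //.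
by rewrite lfunE.
Qed.

Definition gker_incl : ghom gker V := GHom gker_incl_act.

Lemma limg_gker_incl u : limg (gker_incl u) = lker (f u).
Proof.
apply/vspaceP=> x; apply/memv_imgP/idP => [[y _ ->] | xK].
  by rewrite lfunE; exact: subvsP.
by exists (vsproj _ x); rewrite ?memvf // lfunE /= vsprojK.
Qed.

Lemma lker_gker_incl u : lker (gker_incl u) = 0%VS.
Proof.
by apply/eqP/lker0P => x y; rewrite !lfunE => /val_inj.
Qed.

End Kernel.

Section Composition.
Variables (U V W : gmodule) (g : ghom V W) (f : ghom U V).

Fact gcomp_act u v : (u <= v)%MM ->
  ((g v \o f v) \o gact U u v)%VF = (gact W u v \o (g u \o f u))%VF.
Proof. by move=> uv; rewrite -comp_lfunA ghom_act // !comp_lfunA ghom_act. Qed.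

Definition ghom_comp : ghom U W := GHom gcomp_act.

End Composition.

Section StandardResolution.
Variable V : gmodule.

Fixpoint syzygy (i : nat) : gmodule :=
  if i is j.+1 then gker (cover_aug (syzygy j)) else V.

Definition std_d i : ghom (cover (syzygy i.+1)) (cover (syzygy i)) :=
  ghom_comp (gker_incl (cover_aug (syzygy i))) (cover_aug (syzygy i.+1)).

Lemma limg_std_d i u : limg (std_d i u) = lker (cover_aug (syzygy i) u).
Proof. by rewrite [LHS]limg_comp cover_aug_surj limg_gker_incl. Qed.

Lemma lker_std_d i u : lker (std_d i u) = lker (cover_aug (syzygy i.+1) u).
Proof.
have /eqP/lker0P inj := lker_gker_incl (cover_aug (syzygy i)) u.
apply/vspaceP=> x; rewrite !memv_ker [std_d i u x]comp_lfunE.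
by rewrite -(inj_eq inj) linear0.
Qed.

Definition std_resolution : free_resolution V :=
  @FreeResolution V (fun i => cover (syzygy i)) std_d (cover_aug V)
    (fun i => cover_free (syzygy i)) (cover_aug_surj V) (limg_std_d 0)
    (fun i u => etrans (limg_std_d i.+1 u) (esym (lker_std_d i u))).

End StandardResolution.

(* Multigraded Betti numbers: xi_i(u) = dim_F Tor_i(V, F)^u.                  *)
Definition betti (V : gmodule) (i : nat) (u : grade) : nat :=
  \dim {: Tor (std_resolution V) i u}.

(* The n-graded module with components Z u / B u and the maps induced by      *)
(* inclusion.                                                                 *)
Section SubquotientModule.
Variables (L : vectType F) (Z B : grade -> {vspace L}).
Hypothesis Zmono : forall u v, (u <= v)%MM -> (Z u <= Z v)%VS.
Hypothesis Bmono : forall u v, (u <= v)%MM -> (B u <= B v)%VS.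

Definition subquot_act u v : 'Hom(subquot (Z u) (B u), subquot (Z v) (B v)) :=
  (cls (Z v) (B v) \o rep (Z u) (B u))%VF.

Fact subquot_act_id u : subquot_act u u = \1%VF.
Proof. by apply/lfunP=> x; rewrite comp_lfunE repK id_lfunE. Qed.

Fact subquot_act_comp u v w : (u <= v)%MM -> (v <= w)%MM ->
  (subquot_act v w \o subquot_act u v)%VF = subquot_act u w.
Proof.
move=> uv vw; apply/lfunP=> x; rewrite [LHS]comp_lfunE [RHS]comp_lfunE.
rewrite [subquot_act u v x]comp_lfunE [LHS]comp_lfunE.
set y := rep _ _ x; have yv : y \in Z v := subvP (Zmono uv) _ (rep_mem x).
have yB := subvP (Bmono vw) _ (rep_cls (B v) yv).
have dZ : y - rep (Z v) (B v) (cls (Z v) (B v) y) \in Z w.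
  by apply: (subvP (Zmono vw)); rewrite rpredB ?rep_mem.
have := cls_eq0 (B w) dZ; rewrite yB linearB subr_eq0 => /eqP E.
exact: (esym E).
Qed.

Definition subquot_gmodule : gmodule :=
  GModule subquot_act_id subquot_act_comp.

End SubquotientModule.

End GradedModules.

Record cell_complex (F : fieldType) := CellComplex {
  cell :> finType;
  cdim : cell -> nat;
  inc : cell -> cell -> F;
  inc_dim : forall tau sigma, inc tau sigma != 0 -> cdim tau = (cdim sigma).+1;
  inc_inc : forall tau sigma, \sum_rho inc tau rho * inc rho sigma = 0 }.

Section CellComplexes.
Variables (F : fieldType) (X : cell_complex F).

Definition facet (sigma tau : X) : bool := inc tau sigma != 0.

Definition face (sigma tau : X) : bool := connect facet sigma tau.

Definition subcomplex (A : {set X}) : Prop :=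
  forall sigma tau, tau \in A -> face sigma tau -> sigma \in A.

(* Chains of all dimensions live in the space of functions X -> F.            *)
Definition basis_chain (sigma : X) : {ffun X -> F^o} :=
  [ffun rho => (rho == sigma)%:R].

Definition chains (A : {set X}) (q : nat) : {vspace {ffun X -> F^o}} :=
  <<[seq basis_chain sigma | sigma in [set s in A | cdim s == q]]>>%VS.

Definition boundary_fun (c : {ffun X -> F^o}) : {ffun X -> F^o} :=
  [ffun sigma => \sum_tau c tau * inc tau sigma].

Fact boundary_linear : linear boundary_fun.
Proof.
move=> a c c'; apply/ffunP=> s; rewrite !ffunE scaler_sumr -big_split /=.
by apply: eq_bigr => t _; rewrite !ffunE mulrDl -mulrA.
Qed.
HB.instance Definition _ := GRing.isLinear.Build F {ffun X -> F^o}
  {ffun X -> F^o} _ boundary_fun boundary_linear.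

Definition boundary : 'End({ffun X -> F^o}) := linfun boundary_fun.

Definition cycles (A : {set X}) q := (lker boundary :&: chains A q)%VS.
Definition boundaries (A : {set X}) q := (boundary @: chains A q.+1)%VS.

Lemma chains_mono (A A' : {set X}) q : A \subset A' -> (chains A q <= chains A' q)%VS.
Proof.
move=> AA'; apply: sub_span => _ /imageP[s + ->]; rewrite inE => /andP[sA sq].
by apply: image_f; rewrite inE sq (subsetP AA').
Qed.

Lemma boundary_basis s :
  boundary (basis_chain s) = \sum_(r | facet r s) inc s r *: basis_chain r.
Proof.
apply/ffunP=> r; rewrite lfunE /= ffunE sum_ffunE (bigD1 s) //= ffunE eqxx mul1r.
rewrite big1 ?addr0 => [|t /negPf ts]; last by rewrite ffunE ts mul0r.
rewrite big_mkcond (bigD1 r) //= big1 ?addr0 => [|t /negPf tr].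
  rewrite /facet !ffunE eqxx /GRing.scale /= mulr1.
  by case: eqP => [-> | ] .
by case: ifP => // _; rewrite !ffunE eq_sym tr /GRing.scale /= mulr0.
Qed.

Lemma boundary_boundary : (boundary \o boundary)%VF = 0.
Proof.
apply/lfunP=> c; rewrite comp_lfunE zero_lfunE; apply/ffunP=> s.
rewrite lfunE /= !ffunE.
under eq_bigr => r _ do rewrite lfunE /= ffunE mulr_suml.
rewrite exchange_big big1 //= => t _.
under eq_bigr => r _ do rewrite -mulrA.
rewrite -mulr_sumr -[RHS](mulr0 (c t)); congr (_ * _).
exact: (inc_inc t s).
Qed.

Lemma boundaries_cycles (A : {set X}) q :
  subcomplex A -> (boundaries A q <= cycles A q)%VS.
Proof.
move=> sA; rewrite subv_cap; apply/andP; split.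
  apply/subvP=> _ /memv_imgP[c _ ->].
  by rewrite memv_ker -comp_lfunE boundary_boundary zero_lfunE.
rewrite /boundaries limg_span; apply/span_subvP => _ /mapP[_ /imageP[t + ->] ->].
rewrite inE => /andP[tA /eqP tq]; rewrite boundary_basis.
apply: memv_suml => r rt; apply/memvZ/memv_span/image_f; rewrite inE.
rewrite (sA _ _ tA (connect1 rt)) /=.
by have := inc_dim rt; rewrite tq => -[<-].
Qed.

Record filtration (n : nat) := Filtration {
  fil :> 'X_{1..n} -> {set X};
  fil_subcomplex : forall u, subcomplex (fil u);
  fil_mono : forall u v, (u <= v)%MM -> fil u \subset fil v }.

Section Filtration.
Variables (n : nat) (Xf : filtration n).
Local Notation grade := 'X_{1..n}.

Definition exhaustive : Prop := forall sigma, exists u, sigma \in Xf u.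

Definition one_critical : Prop :=
  exists h : X -> grade,
    (forall sigma tau, face sigma tau -> (h sigma <= h tau)%MM) /\
    (forall u, Xf u = [set sigma | (h sigma <= u)%MM]).

Fact cycles_mono q u v : (u <= v)%MM -> (cycles (Xf u) q <= cycles (Xf v) q)%VS.
Proof. by move=> uv; apply/capvS/chains_mono/fil_mono. Qed.

Fact boundaries_mono q u v : (u <= v)%MM ->
  (boundaries (Xf u) q <= boundaries (Xf v) q)%VS.
Proof. by move=> uv; apply/limgS/chains_mono/fil_mono. Qed.

(* V_q, with components H_q(X^u).                                             *)
Definition persistent_homology (q : nat) : gmodule F n :=
  subquot_gmodule (@cycles_mono q) (@boundaries_mono q).

Definition xi (q i : nat) (u : grade) : nat := betti (persistent_homology q) i u.

End Filtration.

(* Entrance grades with respect to a family A; A (u - e_j) is empty by        *)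
(* convention when u - e_j is not in N^n.                                     *)
Definition entrance_grade n (A : 'X_{1..n} -> {set X}) (sigma : X)
    (u : 'X_{1..n}) : Prop :=
  sigma \in A u /\
  forall j : 'I_n, (U_(j) <= u)%MM -> sigma \notin A (u - U_(j))%MM.

Section VectorFields.
Variable Vf : {set X * X}.

Definition discrete_vector_field : Prop :=
  (forall p, p \in Vf -> facet p.1 p.2) /\
  (forall p p' sigma, p \in Vf -> p' \in Vf ->
     sigma \in [:: p.1; p.2] -> sigma \in [:: p'.1; p'.2] -> p = p').

Definition closed_path (r : nat) (s t : nat -> X) : Prop :=
  (forall i, (i < r)%N ->
     [/\ (s i, t i) \in Vf, facet (s i.+1) (t i) & s i.+1 != s i]) /\
  s r = s 0%N.

Definition discrete_gradient_vector_field : Prop :=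
  discrete_vector_field /\
  ~ exists (r : nat) (s t : nat -> X), (0 < r)%N /\ closed_path r s t.

Definition consistent n (A : 'X_{1..n} -> {set X}) : Prop :=
  forall sigma tau, (sigma, tau) \in Vf ->
  forall u, (sigma \in A u) = (tau \in A u).

Definition critical : {set X} :=
  [set sigma | [forall p in Vf, sigma \notin [:: p.1; p.2]]].

Definition morse_filtration n (A : 'X_{1..n} -> {set X}) (u : 'X_{1..n}) : {set X} :=
  critical :&: A u.

(* u is in G(M_q). *)
Definition critical_grades n (A : 'X_{1..n} -> {set X}) (q : nat)
    (u : 'X_{1..n}) : Prop :=
  exists sigma, [/\ sigma \in critical, cdim sigma = q &
    entrance_grade (morse_filtration A) sigma u].

End VectorFields.

End CellComplexes.

Definition join_closure n (G : 'X_{1..n} -> Prop) (u : 'X_{1..n}) : Prop :=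
  exists L : seq 'X_{1..n},
    [/\ L <> [::], forall g, g \in L -> G g & u = \big[@mlcm n/0%MM]_(g <- L) g].

(* Main.v *)
(* In place of long exact sequences of Tor, take a free resolution R of V_q  *)
(* and follow the homology of R / (x_j, j in T) R degree by degree as T       *)
(* grows: a variable outside T is regular on R_i / (x_j, j in T) R_i, so      *)
(* exactness in the degrees near u persists, at a cost of at most one         *)
(* homological degree per variable, and T = {x_1, ..., x_n} computes Tor.     *)
(* Discrete Morse theory gives a chain projection p, homotopic to the         *)
(* identity in every X^u, with p C_q(X^u) = p <M_q^u>; so V_q = Z / B with    *)
(* Z^u and B^u determined by M_q^u and M_{q+1}^u. If u is not a join of       *)
(* grades of critical q-cells, then either there are none below u or, for     *)
(* some j, none of them has j-th coordinate u_j; in the latter case x_j maps  *)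
(* V_q onto degree w for all w <= u with w_j = u_j. Likewise, critical        *)
(* (q+1)-cells yield an x_k that is injective in such degrees. Starting from  *)
(* T = {j, k}, {j} or {k}, one gets the vanishing of Tor.                     *)

From HB Require Import structures.
Require Import Defs.
From mathcomp Require Import all_boot all_order all_algebra.
From mathcomp.multinomials Require Import mpoly.
From mathcomp Require Import zify.

Set Implicit Arguments.
Unset Strict Implicit.
Unset Printing Implicit Defensive.

Import GRing.Theory.
Local Open Scope ring_scope.

(** Suppose u lies in neither join closure; then Tor_i(V_q, F) must vanish in degree u. By
    [morse_projection], V_q is Z/B with Z^w = ker d meet p<M_q^w> and B^w = d p<M_{q+1}^w>, so Z and
    B see w only through the critical cells present. The join of the grades below u of critical
    q-cells is at most u; if it is not u, there are no such cells or it falls short of u in some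
    coordinate j ([stalls_critical]). In the second case Z^{w-e_j} = Z^w for w <= u with w_j = u_j,
    so x_j is onto V_q^w ([pres_surj]). Likewise the (q+1)-cells give a k for which B is constant
    and x_k injective ([pres_inj]).

    For a free resolution R, the homology of R/(x_j, j in T)R runs from that of R (T empty) to Tor
    (T all variables). Multiplication by a new x_k gives a long exact sequence, so vanishing passes
    to larger T ([rel_exactU1], [rel_exact_grow]). For T = {j} the homology is the cokernel and
    kernel of x_j, which settles j = k. For T = {j, k} one also needs that x_k maps ker x_j onto ker
    x_j ([rel_exact2P], [pres_ker]). For Tor_0 the cokernel of x_j suffices; for Tor_n, the n - 1
    variables other than x_k lower the homological degree to no less than 1, where injectivity of
    x_k suffices. *)

(** * Arithmetic of grades *)

Section Grades.
Variable n : nat.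
Implicit Types (u v w g : 'X_{1..n}) (j k : 'I_n).

Lemma mnm1_leE j w : (U_(j) <= w)%MM = (0 < w j)%N.
Proof.
apply/mnm_lepP/idP => [/(_ j)|wj i]; first by rewrite mnm1E eqxx.
by rewrite mnm1E; case: eqP => // <-.
Qed.

Lemma le_subm w v : (w - v <= w)%MM.
Proof. by apply/mnm_lepP=> i; rewrite mnmBE leq_subr. Qed.

Lemma le_subm1 g w j : (g <= w - U_(j))%MM = (g <= w)%MM && (g j <= (w j).-1)%N.
Proof.
apply/mnm_lepP/andP => [H|[/mnm_lepP H Hj] i].
  split; last by have := H j; rewrite mnmBE mnm1E eqxx; lia.
  by apply/mnm_lepP=> i; apply: leq_trans (H i) _; rewrite mnmBE leq_subr.
by rewrite mnmBE mnm1E; have := H i; case: eqP => [<-|_] /=; lia.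
Qed.

Lemma submAC w j k : (w - U_(j) - U_(k) = w - U_(k) - U_(j))%MM.
Proof. by apply/mnmP=> i; rewrite !mnmBE subnAC. Qed.

Lemma submN1 w j k : j != k -> (w - U_(j))%MM k = w k.
Proof. by move=> jk; rewrite mnmBE mnm1E (negPf jk) subn0. Qed.

End Grades.

(** * Regularity of variables on graded free modules *)

Section FreeModules.
Variables (F : fieldType) (n : nat).
Implicit Types (V P : gmodule F n) (T : {set 'I_n}) (u v w : 'X_{1..n}).

Lemma gactM V u v w x : (u <= v)%MM -> (v <= w)%MM ->
  gact V v w (gact V u v x) = gact V u w x.
Proof. by move=> uv vw; rewrite -comp_lfunE gact_comp. Qed.

Lemma ghomM V W (f : ghom V W) u v x : (u <= v)%MM ->
  f v (gact V u v x) = gact W u v (f u x).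
Proof. by move=> uv; rewrite -!comp_lfunE ghom_act. Qed.

(** On the basis, x^(w-g) b goes to x^(v-g) b if g <= v and to 0 otherwise. If v and w agree at j,
    then g_j < w_j gives g_j < v_j, so multiples of x_j stay multiples of x_j. *)
Lemma gfree_retract P v w : gfree P -> (v <= w)%MM ->
  exists2 rho : 'Hom(P w, P v), (forall x, rho (gact P v w x) = x) &
    forall j, (U_(j) <= w)%MM -> v j = w j -> forall y,
      rho (gact P (w - U_(j))%MM w y) \in limg (gact P (v - U_(j))%MM v).
Proof.
move=> [gen genP] vw.
pose val g b := if (g <= v)%MM then gact P g v b else 0.
have [f fP] := linear_of_free [seq gact P g w b | g <- below w, b <- gen g]
  [seq val g b | g <- below w, b <- gen g].
have {fP}: map f [seq gact P g w b | g <- below w, b <- gen g] =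
    [seq val g b | g <- below w, b <- gen g].
  by apply: fP; [exact: basis_free (genP w) | rewrite !size_allpairs_dep].
rewrite map_allpairs => /eq_in_allpairs_dep fP.
have fE g b : (g <= w)%MM -> b \in gen g -> linfun f (gact P g w b) = val g b.
  by move=> gw bg; rewrite lfunE; apply: fP => //; rewrite mem_below.
exists (linfun f).
  suff E : (linfun f \o gact P v w)%VF = \1%VF.
    by move=> x; rewrite -comp_lfunE E id_lfunE.
  apply/eqP; rewrite -subr_eq0; apply/eqP/lfunP=> x.
  rewrite zero_lfunE; apply/eqP; rewrite -memv_ker.
  apply: subvP (memvf x); rewrite -(span_basis (genP v)).
  apply/span_subvP=> _ /allpairsPdep[g [b [gv bg ->]]].
  rewrite mem_below in gv; rewrite memv_ker add_lfunE opp_lfunE comp_lfunE id_lfunE.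
  by rewrite gactM // fE ?(lepm_trans gv vw) // /val gv subrr.
move=> j jw vjw y; rewrite -comp_lfunE.
set h := (_ \o _)%VF; suff: (h @: fullv <= limg (gact P (v - U_(j))%MM v))%VS.
  by move/subvP; apply; apply: memv_img (memvf y).
rewrite -(span_basis (genP _)) limg_span.
apply/span_subvP=> _ /mapP[_ /allpairsPdep[g [b [gv bg ->]]] ->].
rewrite mem_below in gv; rewrite /h comp_lfunE gactM ?le_subm //.
have gw := lepm_trans gv (le_subm _ _); rewrite fE // /val.
case: ifP => gv'; last exact: mem0v.
have gvj : (g <= v - U_(j))%MM.
  by move: gv; rewrite !le_subm1 gv' vjw => /andP[].
by rewrite -(gactM _ gvj (le_subm _ _)) memv_img ?memvf.
Qed.

Definition vars_part T P w : {vspace P w} :=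
  (\sum_(j in T | (U_(j) <= w)%MM) limg (gact P (w - U_(j))%MM w))%VS.

Lemma vars_part0 P w : vars_part set0 P w = 0%VS.
Proof. by rewrite /vars_part big1 // => j; rewrite inE. Qed.

Lemma vars_partU1 T P w k : k \notin T -> (U_(k) <= w)%MM ->
  vars_part (k |: T) P w = (limg (gact P (w - U_(k))%MM w) + vars_part T P w)%VS.
Proof.
move=> kT kw; rewrite /vars_part (bigD1 k) ?setU11 //=; congr (_ + _)%VS.
apply: eq_bigl => j; rewrite !inE; case: eqP => [->|_] /=; last by rewrite andbT.
by rewrite (negPf kT) andbF.
Qed.

Lemma vars_partU1_id T P w k : ~~ (U_(k) <= w)%MM ->
  vars_part (k |: T) P w = vars_part T P w.
Proof.
move=> kw; apply: eq_bigl => j; rewrite !inE; case: eqP => [->|_] //=.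
by rewrite (negPf kw) andbF.
Qed.

Lemma vars_part1 P w k : (U_(k) <= w)%MM ->
  vars_part [set k] P w = limg (gact P (w - U_(k))%MM w).
Proof. by move=> kw; rewrite -[[set k]]setU0 vars_partU1 ?inE // vars_part0 addv0. Qed.

Lemma sub_vars_part T P w j : j \in T -> (U_(j) <= w)%MM ->
  (limg (gact P (w - U_(j))%MM w) <= vars_part T P w)%VS.
Proof. by move=> jT jw; apply: (sumv_sup j); rewrite ?jT. Qed.

Lemma vars_part_gact T P v w x : (v <= w)%MM ->
  x \in vars_part T P v -> gact P v w x \in vars_part T P w.
Proof.
move=> vw /(memv_img (gact P v w)); apply: subvP.
rewrite limg_sum; apply/subv_sumP => j /andP[jT jv].
apply/subvP=> _ /memv_imgP[_ /memv_imgP[x' _ ->] ->].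
have jw := lepm_trans jv vw.
rewrite gactM ?le_subm //; apply: (subvP (sub_vars_part P jT jw)).
have vwj : (v - U_(j) <= w - U_(j))%MM.
  by apply/mnm_lepP=> i; rewrite !mnmBE leq_sub2r // (mnm_lepP vw).
by rewrite -(gactM _ vwj (le_subm _ _)) memv_img ?memvf.
Qed.

Lemma vars_part_ghom T P Q (f : ghom P Q) w x :
  x \in vars_part T P w -> f w x \in vars_part T Q w.
Proof.
move=> /(memv_img (f w)); apply: subvP.
rewrite limg_sum; apply/subv_sumP => j /andP[jT jv].
apply/subvP=> _ /memv_imgP[_ /memv_imgP[x' _ ->] ->].
rewrite ghomM ?le_subm //; apply: (subvP (sub_vars_part Q jT jv)).
by rewrite memv_img ?memvf.
Qed.

Lemma vars_partS T T' P w : T \subset T' -> (vars_part T P w <= vars_part T' P w)%VS.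
Proof.
move=> /subsetP TT'; apply/subv_sumP => j /andP[/TT' jT' jw].
exact: sub_vars_part.
Qed.

(** The retraction of multiplication by x_k recovers y and keeps x_j-multiples among x_j-multiples
    for j in T. *)
Lemma gfree_regular P T k w y : gfree P -> k \notin T -> (U_(k) <= w)%MM ->
  gact P (w - U_(k))%MM w y \in vars_part T P w ->
  y \in vars_part T P (w - U_(k))%MM.
Proof.
move=> freeP kT kw yT; have [rho rhoK rhoT] := gfree_retract freeP (le_subm w U_(k)).
rewrite -[y]rhoK; move/(memv_img rho): yT; apply: subvP.
rewrite limg_sum; apply/subv_sumP => j /andP[jT jw].
have kj : k != j by apply: contraNneq kT => ->.
apply/subvP=> _ /memv_imgP[_ /memv_imgP[x _ ->] ->].
apply: subvP (rhoT j jw _ x); last exact: submN1.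
by apply: sub_vars_part; rewrite // mnm1_leE submN1 // -mnm1_leE.
Qed.

Lemma gfree_inj P k w y : gfree P -> (U_(k) <= w)%MM ->
  gact P (w - U_(k))%MM w y = 0 -> y = 0.
Proof.
move=> freeP kw y0; have [rho rhoK _] := gfree_retract freeP (le_subm w U_(k)).
by rewrite -[y]rhoK y0 linear0.
Qed.

End FreeModules.

(** * Homology of a resolution modulo some variables *)

Section RelativeExactness.
Variables (F : fieldType) (n : nat) (V : gmodule F n) (R : free_resolution V).
Implicit Types (T : {set 'I_n}) (u v w : 'X_{1..n}).

Lemma res_dd i w c : res_d R i w (res_d R i.+1 w c) = 0.
Proof. by apply/eqP; rewrite -memv_ker -res_exact memv_img ?memvf. Qed.

Lemma res_dK i w z : res_d R i w z = 0 -> exists c, z = res_d R i.+1 w c.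
Proof.
move=> /eqP; rewrite -memv_ker -res_exact => /memv_imgP[c _ ->].
by exists c.
Qed.

Lemma res_aug_d w c : res_aug R w (res_d R 0 w c) = 0.
Proof. by apply/eqP; rewrite -memv_ker -res_exact0 memv_img ?memvf. Qed.

Lemma res_augK w z : res_aug R w z = 0 -> exists c, z = res_d R 0 w c.
Proof.
move=> /eqP; rewrite -memv_ker -res_exact0 => /memv_imgP[c _ ->].
by exists c.
Qed.

Lemma res_aug_onto w x : exists z, res_aug R w z = x.
Proof.
by have := memvf x; rewrite -(res_aug_surj R) => /memv_imgP[z _ ->]; exists z.
Qed.

(** The cycles of [R]/(x_j, j in T)[R] pulled back to [R], so that no quotient space has to be
    formed. *)
Definition rel_cycles T i w : {vspace R i w} :=
  match i return {vspace R i w} with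
  | 0 => fullv
  | j.+1 => (res_d R j w @^-1: vars_part T (R j) w)%VS
  end.

(* H_i(R / (x_j, j in T) R) = 0 in degree w. *)
Definition rel_exact T i w : Prop :=
  (rel_cycles T i w <= vars_part T (R i) w + limg (res_d R i w))%VS.

(** This is the segment H_{i+1}(T) -> H_{i+1}(T with k) -> H_i(T)(-e_k) of the long exact sequence
    of multiplication by x_k. *)
Lemma rel_exactU1 T k i w : rel_exact T i.+1 w ->
  ((U_(k) <= w)%MM -> rel_exact T i (w - U_(k))%MM) ->
  rel_exact (k |: T) i.+1 w.
Proof.
have [kT|kT] := boolP (k \in T); first by rewrite (setUidPr _) ?sub1set.
move=> E1 E0; have [kw|kw] := boolP (U_(k) <= w)%MM; last first.
  by rewrite /rel_exact /= !vars_partU1_id.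
have {}E0 := E0 kw; apply/subvP=> z /=; rewrite -memv_preim !vars_partU1 //.
case/memv_addP=> _ /memv_imgP[y _ ->] [a aT dz].
(* The connecting map: x_k d y = - d a lies in the T-part, and x_k is regular modulo T. *)
have : y \in rel_cycles T i (w - U_(k))%MM.
  case: i E1 E0 z y a aT dz => [|i] _ _ z y a aT dz; first exact: memvf.
  rewrite -memv_preim; apply: gfree_regular (res_free R i) kT kw _.
  rewrite -ghomM ?le_subm //.
  move/(congr1 (res_d R i w)): dz; rewrite res_dd linearD => /esym/eqP.
  by rewrite addr_eq0 => /eqP->; rewrite memvN vars_part_ghom.
move/(subvP E0)/memv_addP => [b bT [_ /memv_imgP[c _ ->] yE]].
have zcE : z - gact (R i.+1) (w - U_(k))%MM w c \in rel_cycles T i.+1 w.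
  rewrite -memv_preim linearB /= dz yE ghomM ?le_subm // linearD /= addrAC addrK.
  by rewrite memvD // vars_part_gact ?le_subm.
rewrite -[z](subrK (gact (R i.+1) (w - U_(k))%MM w c)) addrC -addvA memv_add //.
  by rewrite memv_img ?memvf.
exact: (subvP E1).
Qed.

(** In homological degree 0 everything is a cycle, so enlarging T only weakens the requirement. *)
Lemma rel_exactS0 T T' w : T \subset T' -> rel_exact T 0 w -> rel_exact T' 0 w.
Proof.
by move=> TT' E; apply: subv_trans E _; apply: addvS => //; apply: vars_partS.
Qed.

(* Each additional variable costs one homological degree. *)
Lemma rel_exact_grow T T' i u : T \subset T' ->
  (forall i' w, (i' <= i)%N -> (i - #|T' :\: T| <= i')%N -> (w <= u)%MM ->
     {in T, forall j, w j = u j} -> rel_exact T i' w) ->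
  rel_exact T' i u.
Proof.
move: {2}#|_| (erefl #|T' :\: T|) => m; elim: m i T' u => [|m IHm] i T' u mE TT' H.
  move/eqP: mE; rewrite cards_eq0 setD_eq0 => T'T.
  have -> : T' = T by apply/eqP; rewrite eqEsubset T'T.
  by apply: H; rewrite ?lepm_refl ?leq_subr.
have [k kD] : exists k, k \in T' :\: T by apply/card_gt0P; rewrite mE.
have [kT kT'] : k \notin T /\ k \in T' by move: kD; rewrite inE => /andP[].
have mD : #|T' :\ k :\: T| = m.
  by move: mE; rewrite (cardsD1 k) kD !setDDl setUC => -[].
have TD : T \subset T' :\ k by rewrite subsetD1 TT' kT.
case: i H => [|i] H.
  apply: (rel_exactS0 TT'); last by apply: H => //; apply: lepm_refl.
rewrite -(setD1K kT'); apply: rel_exactU1.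
  apply: IHm => // i' w i'i i'm wu; apply: H => //.
  by rewrite mE; move: i'm; rewrite mD; lia.
move=> ku; apply: IHm => // i' w i'i i'm wu wT; apply: H; first exact: leqW.
- by rewrite mE; move: i'm; rewrite mD; lia.
- exact: lepm_trans wu (le_subm _ _).
by move=> j jT; rewrite wT // submN1 //; apply: contraNneq kT => ->.
Qed.

Lemma rel_exact_set0 i w : rel_exact set0 i.+1 w.
Proof.
apply/subvP=> z; rewrite /= -memv_preim !vars_part0 memv0 add0v => /eqP/res_dK[c ->].
by rewrite memv_img ?memvf.
Qed.

Lemma rel_exact_set0_0 w : (fullv : {vspace V w}) = 0%VS -> rel_exact set0 0 w.
Proof.
move=> V0; apply/subvP=> z _; rewrite vars_part0 add0v.
have [|c ->] := @res_augK w z; last by rewrite memv_img ?memvf.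
by apply/eqP; rewrite -memv0 -V0 memvf.
Qed.

Section OneVariable.
Variables (w : 'X_{1..n}) (j : 'I_n).
Hypothesis jw : (U_(j) <= w)%MM.
Local Notation wj := (w - U_(j))%MM.

(** The homology of [R]/x_j[R] is Tor(V, S/x_j): the cokernel of x_j in degree 0, its kernel in
    degree 1, and nothing above. This lemma and the next two draw the vanishing statements. *)
Lemma rel_exact1_0 : limg (gact V wj w) = fullv -> rel_exact [set j] 0 w.
Proof.
move=> sj; apply/subvP=> z _; rewrite vars_part1 //.
have := memvf (res_aug R w z); rewrite -sj => /memv_imgP[v _ zv].
have [y yv] := res_aug_onto v.
have [|c zE] := @res_augK w (z - gact (R 0) wj w y).
  by rewrite linearB /= zv ghomM ?le_subm // yv subrr.
by rewrite -[z](subrK (gact (R 0) wj w y)) addrC zE memv_add // memv_img ?memvf.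
Qed.

Lemma rel_exact1_1 : lker (gact V wj w) = 0%VS -> rel_exact [set j] 1 w.
Proof.
move=> /eqP/lker0P ij; apply/subvP=> z; rewrite /= -memv_preim !vars_part1 //.
move=> /memv_imgP[y _ dz].
have [|c yE] := @res_augK wj y.
  by apply: ij; rewrite -ghomM ?le_subm // -dz res_aug_d linear0.
have [|e zE] := @res_dK 0 w (z - gact (R 1) wj w c).
  by rewrite linearB /= dz ghomM ?le_subm // yE subrr.
by rewrite -[z](subrK (gact (R 1) wj w c)) addrC zE memv_add // memv_img ?memvf.
Qed.

Lemma rel_exact1_SS i : rel_exact [set j] i.+2 w.
Proof.
rewrite -[[set j]]setU0; apply: rel_exactU1 => [|_]; exact: rel_exact_set0.
Qed.

End OneVariable.

Section TwoVariables.
Variables (w : 'X_{1..n}) (j k : 'I_n).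
Hypotheses (jk : j != k) (jw : (U_(j) <= w)%MM) (kw : (U_(k) <= w)%MM).
Local Notation wj := (w - U_(j))%MM.
Local Notation wk := (w - U_(k))%MM.
Local Notation wjk := (w - U_(j) - U_(k))%MM.

Let wjk_wj : (wjk <= wj)%MM := le_subm _ _.
Let wjk_wk : (wjk <= wk)%MM.
Proof. by rewrite submAC le_subm. Qed.
Let wj_w : (wj <= w)%MM := le_subm _ _.
Let wk_w : (wk <= w)%MM := le_subm _ _.

Let vars_part2 (P : gmodule F n) : vars_part [set j; k] P w =
  (limg (gact P wj w) + limg (gact P wk w))%VS.
Proof. by rewrite vars_partU1 ?inE // vars_part1. Qed.

(** Common end of both chases: up to boundaries, (y, y') is the Koszul pair (x_k c, - x_j c), which
    cancels in x_j y + x_k y'. So z - z' is a cycle of [R], hence a boundary. *)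
Let rel_exact2 i z y y' e e' :
  res_d R i w z = gact (R i) wj w y + gact (R i) wk w y' ->
  forall c, y = gact (R i) wjk wj c + res_d R i wj e ->
            y' = - gact (R i) wjk wk c + res_d R i wk e' ->
  z \in (vars_part [set j; k] (R i.+1) w + limg (res_d R i.+1 w))%VS.
Proof.
move=> dz c yE y'E; pose z' := gact (R i.+1) wj w e + gact (R i.+1) wk w e'.
have [|f zE] := @res_dK i w (z - z').
  rewrite linearB linearD /= !ghomM // dz yE y'E !linearD linearN /= !gactM //.
  set a := gact _ _ _ c; set b := gact _ _ _ _; set b' := gact _ _ _ _.
  by rewrite -opprD [X in X - _]addrACA subrr add0r subrr.
rewrite -[z](subrK z') addrC zE vars_part2 memv_add ?memv_img ?memvf //.
by rewrite memv_add ?memv_img ?memvf.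
Qed.

Hypothesis surj_j : forall v, (v <= w)%MM -> v j = w j ->
  limg (gact V (v - U_(j))%MM v) = fullv.
Hypothesis inj_k : forall v, (v <= w)%MM -> v k = w k ->
  lker (gact V (v - U_(k))%MM v) = 0%VS.
Hypothesis ker_j : forall x, gact V wj w x = 0 ->
  exists2 x', gact V wjk wj x' = x & gact V wjk wk x' = 0.

(* In both chases the point is that x_k acts bijectively on the kernel of x_j *)
(* on V, which is H_1(R / x_j R).                                             *)
Lemma rel_exact2_1 : rel_exact [set j; k] 1 w.
Proof.
apply/subvP=> z; rewrite /= -memv_preim vars_part2.
case/memv_addP=> _ /memv_imgP[y _ ->] [_ /memv_imgP[y' _ ->] dz].
have : limg (gact V wjk wk) = fullv.
  by rewrite submAC surj_j ?le_subm // submN1 // eq_sym.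
move: (memvf (res_aug R wk y')) => + sj; rewrite -sj => /memv_imgP[v _ y'v].
(* With [ ] for classes in V: [y'] = x_j v, and x_j ([y] + x_k v) = x_j [y] + x_k [y'] = [d z] =
   0. *)
have [|n' n'E n'0] := ker_j (x := res_aug R wj y + gact V wjk wj v).
  rewrite linearD /= gactM // -(gactM _ wjk_wk wk_w) -y'v -!ghomM //.
  by rewrite -linearD /= -dz res_aug_d.
(* The Koszul witness: x_k (n' - v) = [y] and x_j (n' - v) = - [y']. *)
have [c cE] := res_aug_onto (n' - v).
have [|e yE] := @res_augK wj (y - gact (R 0) wjk wj c).
  by rewrite linearB /= ghomM // cE linearB /= n'E addrK subrr.
have [|e' y'E] := @res_augK wk (y' + gact (R 0) wjk wk c).
  by rewrite linearD /= ghomM // cE linearB /= n'0 sub0r y'v subrr.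
apply: (rel_exact2 dz (c := c) (e := e) (e' := e')).
  by rewrite -yE addrC subrK.
by rewrite -y'E addrC addrK.
Qed.

Lemma rel_exact2_2 : rel_exact [set j; k] 2 w.
Proof.
apply/subvP=> z; rewrite /= -memv_preim vars_part2.
case/memv_addP=> _ /memv_imgP[y _ ->] [_ /memv_imgP[y' _ ->] dz].
have dyy' : gact (R 0) wj w (res_d R 0 wj y) + gact (R 0) wk w (res_d R 0 wk y') = 0.
  by rewrite -!ghomM // -linearD /= -dz res_dd.
have jwk : (U_(j) <= wk)%MM by rewrite mnm1_leE submN1 1?eq_sym // -mnm1_leE.
have kwj : (U_(k) <= wj)%MM by rewrite mnm1_leE submN1 // -mnm1_leE.
(* Modulo x_j the relation reads x_k d y' = 0, and x_k is regular on R_0/x_j R_0. *)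
have : res_d R 0 wk y' \in vars_part [set j] (R 0) wk.
  apply: gfree_regular (res_free R 0) _ kw _; first by rewrite inE eq_sym.
  move/eqP: dyy'; rewrite addrC addr_eq0 => /eqP ->.
  by rewrite vars_part1 // memvN memv_img ?memvf.
rewrite vars_part1 // submAC => /memv_imgP[t _ y't].
have yt : res_d R 0 wj y = - gact (R 0) wjk wj t.
  apply/eqP; rewrite -addr_eq0; apply/eqP.
  apply: gfree_inj (res_free R 0) jw _.
  by rewrite linearD /= gactM // -(gactM _ wjk_wk wk_w) -y't.
(* The class of [t] satisfies x_k [t] = - [d y] = 0, so it is zero by injectivity. *)
have [|f tE] := @res_augK wjk t.
  have /eqP/lker0P := inj_k (v := wj) (le_subm _ _) (submN1 _ jk); apply.
  by rewrite linear0 -ghomM // -[gact _ _ _ _]opprK -yt linearN /= res_aug_d oppr0.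
have [|e yE] := @res_dK 0 wj (y + gact (R 1) wjk wj f).
  by rewrite linearD /= yt ghomM // tE addNr.
have [|e' y'E] := @res_dK 0 wk (y' - gact (R 1) wjk wk f).
  by rewrite linearB /= y't ghomM // tE subrr.
apply: (rel_exact2 dz (c := - f) (e := e) (e' := e')).
  by rewrite -yE linearN /= addrC addrK.
by rewrite -y'E linearN opprK /= addrC subrK.
Qed.

Lemma rel_exact2P i : rel_exact [set j; k] i w.
Proof.
case: i => [|[|[|i]]].
- apply: (@rel_exactS0 [set j]); first by rewrite subsetUl.
  by apply: rel_exact1_0 => //; apply: surj_j => //; apply: lepm_refl.
- exact: rel_exact2_1.
- exact: rel_exact2_2.
rewrite setUC; apply: rel_exactU1 => [|_]; first exact: rel_exact1_SS.
apply: rel_exact1_SS; by rewrite mnm1_leE submN1 1?eq_sym // -mnm1_leE.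
Qed.

End TwoVariables.

End RelativeExactness.

(** * Vanishing criteria for Tor *)

Lemma dim_subquot_eq0 (F : fieldType) (L : vectType F) (Z B : {vspace L}) :
  (Z <= B)%VS -> \dim {:subquot Z B} = 0%N.
Proof.
move=> ZB; have := capv_diff Z B; rewrite (capv_idPl _); last first.
  by apply: subv_trans (diffvSl _ _) ZB.
by move=> E; rewrite dimvf [LHS](_ : _ = \dim (Z :\: B)) // E dimv0.
Qed.

Section TorVanishing.
Variables (F : fieldType) (n : nat) (V : gmodule F n) (R : free_resolution V).
Implicit Types (u v w : 'X_{1..n}).

Lemma irrelevant_partE (P : gmodule F n) u :
  irrelevant_part P u = vars_part setT P u.
Proof. by apply: eq_bigl => j; rewrite inE. Qed.

Lemma tensF_hom_cls (P Q : gmodule F n) (f : ghom P Q) u x :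
  tensF_hom f u (cls fullv (irrelevant_part P u) x) =
  cls fullv (irrelevant_part Q u) (f u x).
Proof.
rewrite /tensF_hom 2!comp_lfunE; set y := rep _ _ _.
have /eqP : cls fullv (irrelevant_part Q u) (f u (x - y)) == 0.
  rewrite cls_eq0 ?memvf // irrelevant_partE; apply: vars_part_ghom.
  by rewrite -irrelevant_partE; apply: rep_cls (memvf x).
by rewrite linearB linearB => /eqP; rewrite subr_eq0 => /eqP.
Qed.

Lemma Tor_eq0 i u : rel_exact R setT i u -> \dim {:Tor R i u} = 0%N.
Proof.
move=> E; apply: dim_subquot_eq0; apply/subvP=> t tZ.
have : rep fullv (irrelevant_part (R i) u) t \in rel_cycles R setT i u.
  case: i E t tZ => [|i] E t tZ; first exact: memvf.
  rewrite -memv_preim -irrelevant_partE -(cls_eq0 _ (memvf _)).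
  by move: tZ; rewrite memv_ker /= /tensF_hom 2!comp_lfunE.
move/(subvP E)/memv_addP => [a aT [_ /memv_imgP[c _ ->] tE]].
rewrite -[t]repK tE linearD /=.
have /eqP-> : cls fullv (irrelevant_part (R i) u) a == 0.
  by rewrite cls_eq0 ?memvf // irrelevant_partE.
by rewrite add0r -tensF_hom_cls memv_img ?memvf.
Qed.

Lemma Tor_eq0_of_zero i u :
  (forall w, (w <= u)%MM -> (fullv : {vspace V w}) = 0%VS) ->
  \dim {:Tor R i u} = 0%N.
Proof.
move=> V0; apply: Tor_eq0; apply: (rel_exact_grow (T := set0)); rewrite ?sub0set //.
move=> [|i'] w _ _ wu _; last exact: rel_exact_set0.
by apply: rel_exact_set0_0; apply: V0.
Qed.

(** Here u = 0, and no multiple of a variable lives in degree 0: tensoring changes nothing there. *)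
Lemma Tor_eq0_of_minimal i u : (0 < i)%N ->
  (forall j, (U_(j) <= u)%MM = false) -> \dim {:Tor R i u} = 0%N.
Proof.
case: i => // i _ u0; apply: Tor_eq0.
have E P : vars_part setT P u = vars_part set0 P u.
  by apply: eq_bigl => j; rewrite u0 !andbF.
by have := @rel_exact_set0 _ _ _ R i u; rewrite /rel_exact /= !E.
Qed.

Lemma Tor_0_eq0 u j : (U_(j) <= u)%MM ->
  limg (gact V (u - U_(j))%MM u) = fullv -> \dim {:Tor R 0 u} = 0%N.
Proof.
move=> ju sj; apply: Tor_eq0; apply: (@rel_exactS0 _ _ _ _ [set j]); rewrite ?subsetT //.
exact: rel_exact1_0.
Qed.

Lemma agree_le (u w : 'X_{1..n}) j : (U_(j) <= u)%MM -> w j = u j -> (U_(j) <= w)%MM.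
Proof. by rewrite !mnm1_leE => ju ->. Qed.

Lemma Tor_n_eq0 u k : (U_(k) <= u)%MM ->
  (forall w, (w <= u)%MM -> w k = u k ->
    lker (gact V (w - U_(k))%MM w) = 0%VS) ->
  \dim {:Tor R n u} = 0%N.
Proof.
move=> ku ik; apply: Tor_eq0; apply: (rel_exact_grow (T := [set k])); rewrite ?subsetT //.
(* Adding the n - 1 variables other than k to {k} leaves only homological degrees from 1 up. *)
move=> i' w _; have -> : (n - #|[set: 'I_n] :\: [set k]| = 1)%N.
  by have := cardsC [set k]; rewrite setTD cards1 card_ord; set c := #|_|; lia.
case: i' => // -[|i'] _ wu wk; last first.
  apply: rel_exact1_SS; apply: agree_le ku _; exact: wk (set11 k).
have wku := wk _ (set11 k).
by apply: rel_exact1_1; [exact: agree_le ku _ | exact: ik].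
Qed.

Lemma Tor_eq0_1 i u j : (U_(j) <= u)%MM ->
  (forall w, (w <= u)%MM -> w j = u j ->
    limg (gact V (w - U_(j))%MM w) = fullv) ->
  (forall w, (w <= u)%MM -> w j = u j ->
    lker (gact V (w - U_(j))%MM w) = 0%VS) ->
  \dim {:Tor R i u} = 0%N.
Proof.
move=> ju sj ij; apply: Tor_eq0; apply: (rel_exact_grow (T := [set j])); rewrite ?subsetT //.
move=> i' w _ _ wu wj; have wju := wj _ (set11 j); have jw := agree_le ju wju.
case: i' => [|[|i']]; last exact: rel_exact1_SS.
  by apply: rel_exact1_0 => //; apply: sj.
by apply: rel_exact1_1 => //; apply: ij.
Qed.

Lemma Tor_eq0_2 i u j k : j != k -> (U_(j) <= u)%MM -> (U_(k) <= u)%MM ->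
  (forall w, (w <= u)%MM -> w j = u j ->
    limg (gact V (w - U_(j))%MM w) = fullv) ->
  (forall w, (w <= u)%MM -> w k = u k ->
    lker (gact V (w - U_(k))%MM w) = 0%VS) ->
  (forall w, (w <= u)%MM -> w j = u j -> w k = u k -> forall x,
    gact V (w - U_(j))%MM w x = 0 ->
    exists2 x', gact V (w - U_(j) - U_(k))%MM (w - U_(j))%MM x' = x &
                gact V (w - U_(j) - U_(k))%MM (w - U_(k))%MM x' = 0) ->
  \dim {:Tor R i u} = 0%N.
Proof.
move=> jk ju ku sj ik Nj; apply: Tor_eq0.
apply: (rel_exact_grow (T := [set j; k])); rewrite ?subsetT //.
move=> i' w _ _ wu wjk; have wj := wjk _ (set21 j k); have wk := wjk _ (set22 j k).
apply: rel_exact2P => //; try by apply: agree_le; eassumption.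
- by move=> v vw vj; apply: sj; [exact: lepm_trans vw wu | rewrite vj].
- by move=> v vw vk; apply: ik; [exact: lepm_trans vw wu | rewrite vk].
exact: Nj.
Qed.

End TorVanishing.

(** * Modules presented as Z/B *)

Section PresentedModules.
Variables (F : fieldType) (n : nat) (V : gmodule F n) (R : free_resolution V).
Variables (L : vectType F) (Z B : 'X_{1..n} -> {vspace L}).
Variable pr : forall u, 'Hom(L, V u).
Hypothesis Zmono : forall u v, (u <= v)%MM -> (Z u <= Z v)%VS.
Hypothesis BZ : forall u, (B u <= Z u)%VS.
Hypothesis pr_onto : forall u, (pr u @: Z u)%VS = fullv.
Hypothesis pr_eq0 : forall u z, z \in Z u -> (pr u z == 0) = (z \in B u).
Hypothesis pr_act : forall u v z, (u <= v)%MM -> z \in Z u ->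
  gact V u v (pr u z) = pr v z.
Implicit Types (u v w : 'X_{1..n}).

Lemma pres_surj w j : Z (w - U_(j))%MM = Z w ->
  limg (gact V (w - U_(j))%MM w) = fullv.
Proof.
move=> Zw; apply/eqP; rewrite eqEsubv subvf -(pr_onto w) -Zw /=.
apply/subvP=> _ /memv_imgP[z zZ ->].
by rewrite -(pr_act (le_subm _ _) zZ) memv_img ?memvf.
Qed.

Lemma pres_lift u (x : V u) : exists2 z, z \in Z u & x = pr u z.
Proof. by have := memvf x; rewrite -pr_onto => /memv_imgP[z zZ ->]; exists z. Qed.

Lemma pres_inj w k : B (w - U_(k))%MM = B w ->
  lker (gact V (w - U_(k))%MM w) = 0%VS.
Proof.
move=> Bw; apply/eqP; rewrite -subv0; apply/subvP=> x.
have [z zZ ->] := pres_lift x.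
have zZw := subvP (Zmono (le_subm w U_(k)%MM)) _ zZ.
rewrite memv_ker (pr_act (le_subm _ _) zZ) pr_eq0 //.
by rewrite -Bw memv0 pr_eq0.
Qed.

(** If x_j kills the class of z, then z is in B w = B (w - e_k), hence in Z (w - e_k) = Z (w - e_k -
    e_j); the same z represents x'. *)
Lemma pres_ker w j k : Z (w - U_(k) - U_(j))%MM = Z (w - U_(k))%MM ->
  B (w - U_(k))%MM = B w -> forall x, gact V (w - U_(j))%MM w x = 0 ->
  exists2 x', gact V (w - U_(j) - U_(k))%MM (w - U_(j))%MM x' = x &
              gact V (w - U_(j) - U_(k))%MM (w - U_(k))%MM x' = 0.
Proof.
rewrite -submAC => Zw Bw x; have [z zZ ->] := pres_lift x.
have kk : (w - U_(j) - U_(k) <= w - U_(k))%MM by rewrite submAC le_subm.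
have zZw := subvP (Zmono (le_subm w U_(j)%MM)) _ zZ.
rewrite (pr_act (le_subm _ _) zZ) => /eqP; rewrite pr_eq0 // -Bw => zB.
have zZk := subvP (BZ _) _ zB.
exists (pr (w - U_(j) - U_(k))%MM z); rewrite pr_act ?le_subm ?Zw //.
by apply/eqP; rewrite pr_eq0.
Qed.

(* The monotone family A acquires nothing new when one coordinate reaches     *)
(* that of u.                                                                 *)
Definition stalls (A : 'X_{1..n} -> {vspace L}) u : Prop :=
  (forall w, (w <= u)%MM -> A w = 0%VS) \/
  exists2 j, (U_(j) <= u)%MM &
    forall w, (w <= u)%MM -> w j = u j -> A (w - U_(j))%MM = A w.

Let V_eq0 u : (forall w, (w <= u)%MM -> Z w = 0%VS) ->
  forall w, (w <= u)%MM -> (fullv : {vspace V w}) = 0%VS.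
Proof. by move=> Z0 w wu; rewrite -pr_onto Z0 // limg0. Qed.

Lemma Tor_0_pres u : stalls Z u -> \dim {:Tor R 0 u} = 0%N.
Proof.
case=> [/V_eq0|[j ju Zj]]; first exact: Tor_eq0_of_zero.
by apply: (Tor_0_eq0 _ ju); apply/pres_surj/Zj; rewrite ?lepm_refl.
Qed.

(** A family that vanishes below u stalls in every direction, so any available one may be
    prescribed. *)
Lemma stalls_dir u (A : 'X_{1..n} -> {vspace L}) : stalls A u ->
  forall j0, (U_(j0) <= u)%MM -> exists2 j, (U_(j) <= u)%MM &
    forall w, (w <= u)%MM -> w j = u j -> A (w - U_(j))%MM = A w.
Proof.
case=> [A0|//] j ju; exists j => // w wu _.
by rewrite !A0 // (lepm_trans (le_subm _ _) wu).
Qed.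

Lemma Tor_n_pres u : (0 < n)%N -> stalls B u -> \dim {:Tor R n u} = 0%N.
Proof.
move=> n0 Bs; have [k0 ku0|u0] := pickP (fun j => U_(j) <= u)%MM.
  have [k ku Bk] := stalls_dir Bs ku0.
  by apply: (Tor_n_eq0 _ ku) => w wu wk; apply/pres_inj/Bk.
(* No variable fits below u, and n > 0 makes the homological degree positive. *)
exact: Tor_eq0_of_minimal.
Qed.

Lemma Tor_pres i u : stalls Z u -> stalls B u -> \dim {:Tor R i u} = 0%N.
Proof.
case=> [/V_eq0 ? _|[j ju Zj]]; first exact: Tor_eq0_of_zero.
move=> /stalls_dir/(_ j ju)[k ku Bk].
have [jk|jk] := eqVneq j k.
  subst k; apply: (Tor_eq0_1 _ _ ju) => w wu wj.
    exact/pres_surj/Zj.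
  exact/pres_inj/Bk.
apply: (Tor_eq0_2 _ _ jk ju ku) => w wu.
- by move=> wj; apply/pres_surj/Zj.
- by move=> wk; apply/pres_inj/Bk.
move=> wj wk; apply: pres_ker; last exact: Bk.
by apply: Zj; [exact: lepm_trans (le_subm _ _) wu | rewrite submN1 // eq_sym].
Qed.

End PresentedModules.

(** * A chain projection from an approximate inverse of the boundary *)

Section HomotopyRetract.
Variables (F : fieldType) (L : vectType F) (d V0 a : 'End(L)) (K : nat).
Hypothesis dd : forall x, d (d x) = 0.
Hypothesis aa : forall x, a (a x) = a x.
Hypothesis V0a : forall x, V0 (a x) = V0 x.
Hypothesis aV0 : forall x, a (V0 x) = 0.

Let N : 'End(L) := (a - (a \o (d \o V0)))%VF.
Let NE x : N x = a x - a (d (V0 x)).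
Proof. by rewrite add_lfunE opp_lfunE !comp_lfunE. Qed.

Hypothesis N_nilp : forall x, iter K N x = 0.

Let G : 'End(L) := \sum_(k < K) iter k (comp_lfun N) \1%VF.
Let GE x : G x = \sum_(k < K) iter k N x.
Proof.
rewrite sum_lfunE; apply: eq_bigr => k _.
by elim: (k : nat) => [|m IH]; rewrite ?id_lfunE //= comp_lfunE IH.
Qed.

Let telescope x : \sum_(k < K) iter k N x - \sum_(k < K) iter k.+1 N x = x.
Proof.
rewrite -sumrB -(big_mkord xpredT (fun k => iter k N x - iter k.+1 N x)).
under eq_bigr => k _ do rewrite -opprB.
by rewrite sumrN telescope_sumr // N_nilp sub0r opprK.
Qed.

Let G_sub x : G x - N (G x) = x.
Proof. by rewrite GE linear_sum telescope. Qed.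

Let sub_G x : G (x - N x) = x.
Proof.
rewrite linearB /= !GE -[RHS]telescope; congr (_ - _).
by apply: eq_bigr => k _; rewrite iterSr.
Qed.

Let Na x : N (a x) = N x.
Proof. by rewrite !NE aa V0a. Qed.

Let aN x : a (N x) = N x.
Proof. by rewrite !NE linearB /= !aa. Qed.

Let aG x : a (G (a x)) = G (a x).
Proof.
rewrite GE linear_sum; apply: eq_bigr => k _.
by case: (k : nat) => [|m] /=; rewrite ?aa ?aN.
Qed.

(* V0 inverts the diagonal of the block of d from heads to tails; the         *)
(* Neumann series G corrects V0 to an inverse of the whole block.             *)
Lemma homotopy_retract : exists p : 'End(L),
  [/\ forall x, p (p x) = p x,
      forall x, p (d x) = d (p x),
      forall x, p (V0 x) = 0
    & exists h : 'End(L),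
      [/\ forall x, p x = x - d (h x) - h (d x),
          forall x, exists y, h x = V0 y,
          forall x, a (d (h x)) = a x
        & forall U W : {vspace L},
            (forall x, x \in U -> V0 x \in W) ->
            (forall x, x \in W -> d x \in U) ->
            (forall x, x \in U -> a x \in U) ->
            forall x, x \in U -> h x \in W]].
Proof.
pose h := (V0 \o (G \o a))%VF.
have hE x : h x = V0 (G (a x)) by rewrite !comp_lfunE.
have adV0 x : a (d (V0 x)) = a x - N x by rewrite NE subKr.
have hV0 x : h (V0 x) = 0 by rewrite hE aV0 !linear0.
have hdV0 x : h (d (V0 x)) = V0 x by rewrite hE adV0 -Na sub_G V0a.
have adh x : a (d (h x)) = a x by rewrite hE adV0 aG G_sub.
have hdh x : h (d (h x)) = h x by rewrite [LHS]hE adh -hE.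
have hh x : h (h x) = 0 by rewrite [h x]hE hV0.
(* The identities h h = 0 and h d h = h make p idempotent. *)
pose p := (\1 - (d \o h) - (h \o d))%VF.
have pE x : p x = x - d (h x) - h (d x).
  by rewrite !add_lfunE !opp_lfunE !comp_lfunE id_lfunE.
have pd x : p (d x) = d (p x).
  by rewrite !pE dd !linearB /= dd !linear0 !addr0.
have ph x : p (h x) = 0 by rewrite pE hh hdh !linear0 addr0 subrr.
have pV0 x : p (V0 x) = 0 by rewrite pE hV0 hdV0 !linear0 addr0 subrr.
exists p; split => //.
  by move=> x; rewrite [X in p X]pE !linearB /= ph pd ph !linear0 !addr0.
exists h; split => //; first by move=> x; exists (G (a x)); rewrite hE.
move=> U W UV Wd Ua x xU; rewrite hE; apply: (UV _ _); rewrite GE; apply: memv_suml => k _.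
elim: (k : nat) => [|m IH] /=; first exact: Ua.
by rewrite NE rpredB ?Ua // Wd // UV.
Qed.

End HomotopyRetract.

(** * Chains and their supports *)

Section Chains.
Variables (F : fieldType) (X : cell_complex F).
Local Notation L := {ffun X -> F^o}.
Implicit Types (A : {set X}) (c : L).

Definition restr_fun A c : L := [ffun s => if s \in A then c s else 0].

Fact restr_linear A : linear (restr_fun A).
Proof.
move=> k c c'; apply/ffunP=> s; rewrite !ffunE.
by case: ifP => //; rewrite scaler0 addr0.
Qed.
HB.instance Definition _ A :=
  GRing.isLinear.Build F L L _ (restr_fun A) (restr_linear A).

Definition restr A : 'End(L) := linfun (restr_fun A).

Lemma restrE A c s : restr A c s = if s \in A then c s else 0.
Proof. by rewrite lfunE /= ffunE. Qed.

Lemma boundaryE c s : boundary X c s = \sum_t c t * inc t s.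
Proof. by rewrite lfunE /= ffunE. Qed.

Lemma boundaryK c : boundary X (boundary X c) = 0.
Proof. by rewrite -comp_lfunE boundary_boundary zero_lfunE. Qed.

Lemma mem_chains A q c :
  reflect (forall s, c s != 0 -> s \in A /\ cdim s = q) (c \in chains A q).
Proof.
apply: (iffP idP) => [cA s|H].
  pose S := [set s in A | cdim s == q].
  have /subvP/(_ c cA) : (chains A q <= lker (restr (~: S)))%VS.
    apply/span_subvP=> _ /imageP[t tS ->]; rewrite memv_ker.
    apply/eqP/ffunP=> r; rewrite restrE inE [RHS]ffunE; case: ifP => // rS.
    by rewrite ffunE; case: eqP rS => // ->; rewrite tS.
  rewrite memv_ker => /eqP/ffunP/(_ s); rewrite restrE [RHS]ffunE !inE.
  case: ifP => [_ ->|/negbFE/andP[-> /eqP-> //]]; by rewrite eqxx.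
have -> : c = \sum_s c s *: basis_chain s.
  apply/ffunP=> s; rewrite sum_ffunE (bigD1 s) //= !ffunE eqxx.
  rewrite [X in _ + X]big1 ?addr0; first by rewrite /GRing.scale /= mulr1.
  by move=> t /negPf ts; rewrite !ffunE eq_sym ts; exact: mulr0.
apply: memv_suml => s _; have [->|/H[sA /eqP sq]] := eqVneq (c s) 0.
  by rewrite scale0r mem0v.
by apply/memvZ/memv_span/image_f; rewrite inE sA.
Qed.

Lemma eq_chains A A' q :
  [set s in A | cdim s == q] = [set s in A' | cdim s == q] ->
  chains A q = chains A' q.
Proof. by rewrite /chains => ->. Qed.

Lemma chains_eq0 A q : (forall s, s \in A -> cdim s <> q) -> chains A q = 0%VS.
Proof.
move=> H; apply/eqP; rewrite -subv0; apply/subvP=> c /mem_chains cA.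
rewrite memv0; apply/eqP/ffunP=> s; rewrite [RHS]ffunE.
by apply/eqP/contraT => /cA[/H].
Qed.

Lemma restr_chains A' A q c : c \in chains A q -> restr A' c \in chains (A' :&: A) q.
Proof.
move/mem_chains=> cA; apply/mem_chains=> s; rewrite restrE inE.
by case: ifP => [_ /cA//|]; rewrite eqxx.
Qed.

Lemma boundary_chains A q c : subcomplex A ->
  c \in chains A q.+1 -> boundary X c \in chains A q.
Proof.
move=> sA cA; have /subvP/(_ (boundary X c)) := boundaries_cycles q sA.
by rewrite memv_cap (memv_img _ cA) => /(_ isT)/andP[].
Qed.

Lemma boundary_chains0 A c : c \in chains A 0 -> boundary X c = 0.
Proof.
move/mem_chains=> cA; apply/ffunP=> s; rewrite boundaryE [RHS]ffunE big1 // => t _.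
have [->|/cA[_ t0]] := eqVneq (c t) 0; first by rewrite mul0r.
have [->|/inc_dim] := eqVneq (inc t s) 0; first by rewrite mulr0.
by rewrite t0.
Qed.

End Chains.

(** * Discrete Morse theory: reduction to critical cells *)

Section MorseReduction.
Variables (F : fieldType) (X : cell_complex F) (n : nat).
Variables (Xf : filtration X n) (Vf : {set X * X}).
Hypothesis Vf_gradient : discrete_gradient_vector_field Vf.
Hypothesis Vf_consistent : consistent Vf Xf.
Local Notation L := {ffun X -> F^o}.
Local Notation d := (boundary X).

Definition tails : {set X} := [set s | [exists t, (s, t) \in Vf]].
Definition heads : {set X} := [set t | [exists s, (s, t) \in Vf]].

(** Off [tails] the value is a default: [flow] tests for the pair, and [matching] reads tails
    only. *)
Definition mate (s : X) : X :=
  if [pick t | (s, t) \in Vf] is Some t then t else s.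

Lemma Vf_inc s t : (s, t) \in Vf -> inc t s != 0.
Proof. by move=> st; have [[H _] _] := Vf_gradient; apply: (H _ st). Qed.

Lemma Vf_cdim s t : (s, t) \in Vf -> cdim t = (cdim s).+1.
Proof. by move/Vf_inc/inc_dim. Qed.

Lemma Vf_uniq p p' r : p \in Vf -> p' \in Vf ->
  r \in [:: p.1; p.2] -> r \in [:: p'.1; p'.2] -> p = p'.
Proof. by have [[_ H] _] := Vf_gradient; apply: H. Qed.

Lemma Vf_head_uniq s s' t : (s, t) \in Vf -> (s', t) \in Vf -> s = s'.
Proof.
move=> st s't; suff [] : (s, t) = (s', t) by [].
by apply: (@Vf_uniq _ _ t) => //; rewrite !inE eqxx orbT.
Qed.

Lemma Vf_tail_uniq s t t' : (s, t) \in Vf -> (s, t') \in Vf -> t = t'.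
Proof.
move=> st st'; suff [] : (s, t) = (s, t') by [].
by apply: (@Vf_uniq _ _ s) => //; rewrite !inE eqxx.
Qed.

Lemma tail_not_head s : s \in tails -> s \notin heads.
Proof.
rewrite inE => /existsP[t st]; apply/negP; rewrite inE => /existsP[r rs].
have [sr ts] : (s, t) = (r, s).
  by apply: (@Vf_uniq _ _ s st rs); rewrite !inE eqxx ?orbT.
by have := Vf_cdim st; rewrite ts; lia.
Qed.

Lemma mateE s t : (s, t) \in Vf -> mate s = t.
Proof.
move=> st; rewrite /mate; case: pickP => [t' st'|/(_ t)]; last by rewrite st.
exact: Vf_tail_uniq st' st.
Qed.

Lemma criticalE : critical Vf = ~: (tails :|: heads).
Proof.
apply/setP=> s; rewrite !inE negb_or; apply/forall_inP/andP.
  move=> H; split; apply/negP=> /existsP[t /H]; by rewrite !inE eqxx ?orbT.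
move=> [/negP sT /negP sH] [t t'] tV; rewrite !inE negb_or /=.
apply/andP; split; apply/eqP=> E; [apply: sT | apply: sH]; apply/existsP.
  by exists t'; rewrite E.
by exists t; rewrite E.
Qed.

Definition flow : rel X := [rel s s' |
  [&& (s, mate s) \in Vf, facet s' (mate s) & s' != s]].

Definition height (s : X) : nat := #|connect flow s|.

(** What s' reaches, s reaches; but s' cannot reach s, as that would close a gradient path. *)
Lemma flow_height s s' : flow s s' -> (height s' < height s)%N.
Proof.
move=> ss'; apply: proper_card; apply/properP; split.
  by apply/subsetP=> r; apply: connect_trans; apply: connect1.
exists s; first exact: connect0.
apply/negP=> /connectP[p pP sE]; case: Vf_gradient => _; apply.
pose x i := nth s (s :: s' :: p) i.
exists (size p).+1, x, (mate \o x); split=> //; split; last first.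
  by rewrite [RHS]sE; exact: (nth_last s (s' :: p)).
have /(pathP s) P : path flow s (s' :: p) by rewrite /= ss'.
by move=> i ip; have /and3P[] := P i ip.
Qed.

(** The inverse incidences normalise to 1 the diagonal of boundary after matching, seen on tails. *)
Definition match_fun (c : L) : L :=
  [ffun t => \sum_(s | (s, t) \in Vf) (inc t s)^-1 * c s].

Fact match_linear : linear match_fun.
Proof.
move=> k c c'; apply/ffunP=> t; rewrite !ffunE scaler_sumr -big_split /=.
apply: eq_bigr => s _; rewrite !ffunE mulrDr; congr (_ + _).
by rewrite /GRing.scale /= mulrCA.
Qed.
HB.instance Definition _ := GRing.isLinear.Build F L L _ match_fun match_linear.

Definition matching : 'End(L) := linfun match_fun.

Lemma matchingE c t : matching c t = \sum_(s | (s, t) \in Vf) (inc t s)^-1 * c s.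
Proof. by rewrite lfunE /= ffunE. Qed.

Lemma matching_tails c : matching (restr tails c) = matching c.
Proof.
apply/ffunP=> t; rewrite !matchingE; apply: eq_bigr => s st.
by rewrite restrE inE; case: existsP => // -[]; exists t.
Qed.

Lemma tails_matching c : restr tails (matching c) = 0.
Proof.
apply/ffunP=> t; rewrite restrE [RHS]ffunE; case: ifP => // tT.
rewrite matchingE big1 // => s st; case/negP: (tail_not_head tT).
by rewrite inE; apply/existsP; exists s.
Qed.

Lemma heads_matching c : exists c', restr heads c = matching c'.
Proof.
exists [ffun s => inc (mate s) s * c (mate s)].
apply/ffunP=> t; rewrite restrE matchingE inE; case: existsP => [[s st]|tH].
  rewrite (big_pred1 s) => [|s']; last first.
    by apply/idP/eqP => [s't|-> //]; apply: Vf_head_uniq s't st.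
  by rewrite ffunE (mateE st) mulKf // Vf_inc.
by rewrite big1 // => s st; case: tH; exists s.
Qed.

(** The pair of s' contributes exactly c s' to the boundary of [matching c] at s', so a nonzero
    difference comes from another pair, that is, from a flow step into s'. *)
Lemma flow_step (c : L) s' : s' \in tails -> c s' - d (matching c) s' != 0 ->
  exists2 s, flow s s' & c s != 0.
Proof.
rewrite inE => /existsP[t' s't'] nz.
have [s /andP[ss' cs]|H] := pickP [pred s | flow s s' & c s != 0]; first by exists s.
case/eqP: nz; apply/eqP; rewrite subr_eq0 boundaryE; apply/eqP.
have vanish s t : (s, t) \in Vf -> s != s' -> (inc t s)^-1 * c s * inc t s' = 0.
  move=> st ns; have := H s; rewrite /flow /= (mateE st) st /facet [s' == s]eq_sym ns andbT /=.
  have [->|_] := eqVneq (inc t s') 0; first by rewrite mulr0.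
  by have [-> _|//] := eqVneq (c s) 0; rewrite mulr0 mul0r.
rewrite (bigD1 t') //= big1 => [|t tt'].
  rewrite addr0 matchingE (bigD1 s') //= big1 => [|s /andP[st ns]].
    by rewrite addr0 mulrAC mulVf ?mul1r // Vf_inc.
  have [/eqP|/mulIf inj] := eqVneq (inc t' s') 0; first by rewrite (negPf (Vf_inc s't')).
  by apply: inj; rewrite mul0r vanish.
rewrite matchingE mulr_suml big1 // => s st; apply: vanish => //.
by apply: contraNneq tt' => ss'; rewrite (Vf_tail_uniq s't' (t' := t)) // -ss'.
Qed.

(** Each application of N moves supports along the flow, where the height drops, and heights are
    positive and at most [#|X|]. *)
Lemma flow_nilpotent (N : 'End(L)) :
  (forall c, N c = restr tails c - restr tails (d (matching c))) ->
  forall c, iter #|X| N c = 0.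
Proof.
move=> NE c; suff H k s : iter k N c s != 0 -> (height s + k <= #|X|)%N.
  apply/ffunP=> s; rewrite [RHS]ffunE; apply/eqP/contraT => /H.
  have : (0 < height s)%N by apply/card_gt0P; exists s; apply: connect0.
  by lia.
elim: k s => [|k IH] s' /=; first by rewrite addn0 max_card.
rewrite NE -linearB restrE; case: ifP => [s'T|]; last by rewrite eqxx.
rewrite !ffunE => /(flow_step s'T)[s ss' /IH].
by apply: leq_trans; rewrite addnS -addSn leq_add2r flow_height.
Qed.

Lemma matching_chains u q c :
  c \in chains (Xf u) q -> matching c \in chains (Xf u) q.+1.
Proof.
move=> /mem_chains cX; apply/mem_chains=> t.
have [s /andP[st /cX[sX <-]] _|H] := pickP [pred s | ((s, t) \in Vf) && (c s != 0)].
  by rewrite -(Vf_consistent st) (Vf_cdim st).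
rewrite matchingE big1 ?eqxx // => s st.
by have := H s; rewrite /= st => /negbFE/eqP->; rewrite mulr0.
Qed.

Lemma morse_projection : exists p : 'End(L),
  [/\ forall x, p (p x) = p x,
      forall x, p (d x) = d (p x),
      forall u q x, x \in chains (Xf u) q -> p x \in chains (Xf u) q,
      forall u q x, x \in chains (Xf u) q -> d x = 0 ->
        x - p x \in boundaries (Xf u) q
    & forall u q x, x \in chains (Xf u) q ->
        p x \in (p @: chains (morse_filtration Vf Xf u) q)%VS].
Proof.
have tt c : restr tails (restr tails c) = restr tails c.
  by apply/ffunP=> s; rewrite !restrE; case: (s \in tails).
have [|p [pp pd pV [h [pE hV adh hU]]]] := homotopy_retract (@boundaryK _ X) tt
  matching_tails tails_matching (K := #|X|).
  by apply: flow_nilpotent => c; rewrite add_lfunE opp_lfunE !comp_lfunE.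
have tX u q x : x \in chains (Xf u) q -> restr tails x \in chains (Xf u) q.
  by move/(restr_chains tails); apply: (subvP (chains_mono _ (subsetIr _ _))).
have hX u q x : x \in chains (Xf u) q -> h x \in chains (Xf u) q.+1.
  apply: hU => {}x; [exact: matching_chains | | exact: tX].
  exact/boundary_chains/fil_subcomplex.
have dhX u q x : x \in chains (Xf u) q -> d (h x) \in chains (Xf u) q.
  by move/hX; apply/boundary_chains/fil_subcomplex.
exists p; split=> // u q x xX.
- rewrite pE rpredB ?rpredB ?dhX //; case: q xX => [|q] xX.
    by rewrite (boundary_chains0 xX) linear0 mem0v.
  by apply: hX; apply: boundary_chains xX; apply: fil_subcomplex.
- by move=> dx; rewrite pE dx linear0 subr0 subKr memv_img ?hX.
(* Passing to y clears the tails without changing the image under p; the head part of y is a value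
   of [matching], which p kills, so only critical cells remain. *)
pose y := x - d (h x).
have yX : y \in chains (Xf u) q by rewrite rpredB ?dhX.
have yE : y = restr heads y + restr (critical Vf) y.
  have /ffunP ty : restr tails y = 0 by rewrite linearB /= adh subrr.
  apply/ffunP=> s; rewrite [RHS]ffunE !restrE criticalE !inE.
  have := ty s; rewrite restrE [RHS]ffunE inE.
  case: [exists t, (s, t) \in Vf] => [->|_]; first by rewrite addr0 if_same.
  by case: ifP; rewrite ?addr0 ?add0r.
have -> : p x = p y.
  rewrite linearB /= pd; have [z ->] := hV x.
  by rewrite pV linear0 subr0.
rewrite yE linearD /=; have [z ->] := heads_matching y; rewrite pV add0r.
exact/memv_img/restr_chains.
Qed.

End MorseReduction.

(** * Joins of critical grades, and the conclusion *)

Lemma stalls_image (F : fieldType) n (L : vectType F) (A : 'X_{1..n} -> {vspace L})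
    (f : {vspace L} -> {vspace L}) u :
  f 0%VS = 0%VS -> stalls A u -> stalls (fun w => f (A w)) u.
Proof.
move=> f0 [A0|[j ju Aj]]; [left|right].
  by move=> w wu; rewrite A0.
by exists j => // w wu wj; rewrite Aj.
Qed.

Lemma lem_big_mlcm n (s : seq 'X_{1..n}) m :
  (\big[@mlcm n/0%MM]_(g <- s) g <= m)%MM = all (fun g => g <= m)%MM s.
Proof.
elim: s => [|g s IH]; last by rewrite big_cons lem_mlcm IH.
by rewrite big_nil; apply/mnm_lepP=> i; rewrite mnm0E.
Qed.

Lemma stalls_critical (F : fieldType) (X : cell_complex F) n
    (Xf : filtration X n) (Vf : {set X * X}) q u :
  one_critical Xf -> join_closure (critical_grades Vf Xf q) u \/
  stalls (fun w => chains (morse_filtration Vf Xf w) q) u.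
Proof.
move=> [h [_ XfE]].
pose L := [seq h s | s in [set s in critical Vf | (cdim s == q) && (h s <= u)%MM]].
have mem_L s : s \in critical Vf -> cdim s = q -> (h s <= u)%MM -> h s \in L.
  by move=> sC /eqP sq su; apply: image_f; rewrite inE sC sq.
have LG g : g \in L -> critical_grades Vf Xf q g.
  case/imageP=> s; rewrite inE => /and3P[sC /eqP sq su] ->; exists s; split=> //.
  split; first by rewrite inE sC XfE inE lepm_refl.
  move=> j js; rewrite inE sC XfE inE le_subm1 lepm_refl /=.
  by move: js; rewrite mnm1_leE; lia.
have LE m : (\big[@mlcm n/0%MM]_(g <- L) g <= m)%MM = all (fun g => g <= m)%MM L.
  exact: lem_big_mlcm.
have Lu : (\big[@mlcm n/0%MM]_(g <- L) g <= u)%MM.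
  by rewrite LE; apply/allP=> _ /imageP[s + ->]; rewrite inE => /and3P[].
have [L0|/eqP L0] := eqVneq L [::].
  right; left=> w wu; apply: chains_eq0 => s; rewrite inE => /andP[sC].
  rewrite XfE inE => sw sq; have := mem_L s sC sq (lepm_trans sw wu).
  by rewrite L0.
(* If the join is below u at j, no critical q-cell of grade <= u attains u_j, so lowering w by e_j
   loses none. *)
have [j ju|Lju] := pickP (fun j => (\big[@mlcm n/0%MM]_(g <- L) g)%MM j < u j)%N.
  have uj : (U_(j) <= u)%MM by rewrite mnm1_leE (leq_ltn_trans _ ju).
  right; right; exists j => // w wu wj; apply: eq_chains; apply/setP=> s.
  rewrite 2![s \in finset _]inE ![s \in morse_filtration _ _ _]in_setI.
  have [sC|] //= := boolP (s \in critical Vf); rewrite !XfE !inE le_subm1.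
  have [sq|] := eqVneq (cdim s) q; last by rewrite !andbF.
  rewrite !andbT; have [sw /=|//] := boolP (h s <= w)%MM.
  have := lepm_refl (\big[@mlcm n/0%MM]_(g <- L) g)%MM.
  rewrite LE => /allP/(_ _ (mem_L s sC sq (lepm_trans sw wu)))/mnm_lepP/(_ j).
  by rewrite wj; lia.
left; exists L; split=> //; apply/mnmP=> j; apply/eqP.
by rewrite eqn_leq (mnm_lepP Lu) andbT leqNgt Lju.
Qed.

Theorem corollary5p23 (F : fieldType) (X : cell_complex F) (n : nat)
    (Xf : filtration X n) (Vf : {set X * X})
    (n_ge1 : (1 <= n)%N)
    (Xf_one_critical : one_critical Xf)
    (Xf_exhaustive : exhaustive Xf)
    (Vf_gradient : discrete_gradient_vector_field Vf)
    (Vf_consistent : consistent Vf Xf) :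
  forall q : nat,
    [/\ forall (i : nat) (u : 'X_{1..n}), (i <= n)%N -> xi Xf q i u <> 0%N ->
          join_closure (critical_grades Vf Xf q.+1) u \/
          join_closure (critical_grades Vf Xf q) u,
        forall u : 'X_{1..n}, xi Xf q 0 u <> 0%N ->
          join_closure (critical_grades Vf Xf q) u
      & forall u : 'X_{1..n}, xi Xf q n u <> 0%N ->
          join_closure (critical_grades Vf Xf q.+1) u].
Proof.
move=> q.
have [p [pp pd pX pB pM]] := morse_projection Vf_gradient Vf_consistent.
pose d := boundary X; pose M := morse_filtration Vf Xf.
pose Z u := (lker d :&: p @: chains (M u) q)%VS.
pose B u := (d @: (p @: chains (M u) q.+1))%VS.
pose pr u := cls (cycles (Xf u) q) (boundaries (Xf u) q).
have MX u k : (chains (M u) k <= chains (Xf u) k)%VS.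
  exact/chains_mono/subsetIr.
have pMX u k : (p @: chains (M u) k <= chains (Xf u) k)%VS.
  by apply/subvP=> _ /memv_imgP[x xM ->]; apply/pX/(subvP (MX u k)).
have ZX u : (Z u <= cycles (Xf u) q)%VS by apply: capvS.
have BX u : (B u <= boundaries (Xf u) q)%VS by apply: limgS.
have XB u x : x \in boundaries (Xf u) q -> p x \in B u.
  by move=> /memv_imgP[c cX ->]; rewrite pd memv_img ?pM.
have Zmono u v : (u <= v)%MM -> (Z u <= Z v)%VS.
  by move=> uv; apply/capvS/limgS/chains_mono/setIS/fil_mono.
have BZ u : (B u <= Z u)%VS.
  apply/subvP=> _ /memv_imgP[_ /memv_imgP[c cM ->] ->].
  rewrite memv_cap memv_ker boundaryK eqxx -pd pM //.
  apply: boundary_chains; [exact: fil_subcomplex | exact: (subvP (MX _ _))].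
have pr_onto u : (pr u @: Z u)%VS = fullv.
  apply/eqP; rewrite eqEsubv subvf /=; apply/subvP=> x _.
  (* A cycle z is homologous to p z, which lies in Z u. *)
  have := rep_mem x; rewrite -{2}[x]repK; move: (rep _ _ _) => z zZ.
  have /andP[/eqP dz zX] : (d z == 0) && (z \in chains (Xf u) q).
    by move: zZ; rewrite memv_cap memv_ker.
  have pzZ : p z \in Z u by rewrite memv_cap memv_ker -pd dz linear0 eqxx pM.
  have -> : cls (cycles (Xf u) q) (boundaries (Xf u) q) z = pr u (p z).
    apply/eqP; rewrite -subr_eq0 -linearB cls_eq0 ?pB //.
    by rewrite rpredB // (subvP (ZX u)).
  exact: memv_img.
have pr_eq0 u z : z \in Z u -> (pr u z == 0) = (z \in B u).
  move=> zZ; rewrite cls_eq0 ?(subvP (ZX u)) //.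
  (* p sends boundaries into B u and fixes Z u. *)
  apply/idP/idP => [/XB|/(subvP (BX u)) //].
  by move: zZ; rewrite memv_cap => /andP[_ /memv_imgP[x _ ->]]; rewrite pp.
have pr_act u v z : (u <= v)%MM -> z \in Z u ->
    gact (persistent_homology Xf q) u v (pr u z) = pr v z.
  move=> uv zZ; have zX := subvP (ZX u) _ zZ.
  rewrite /= comp_lfunE; apply/esym/eqP; rewrite -subr_eq0 -linearB cls_eq0.
    exact: (subvP (boundaries_mono Xf q uv)) (rep_cls _ zX).
  by apply: (subvP (cycles_mono Xf q uv)); rewrite rpredB ?rep_mem.
(* Z and B are built from spans of critical cells alone, so they stall whenever those spans do. *)
have sZ u : join_closure (critical_grades Vf Xf q) u \/ stalls Z u.
  case: (stalls_critical Vf q u Xf_one_critical) => [|sM]; [by left | right].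
  by apply: (stalls_image (f := fun A => (lker d :&: p @: A)%VS)) sM; rewrite limg0 capv0.
have sB u : join_closure (critical_grades Vf Xf q.+1) u \/ stalls B u.
  case: (stalls_critical Vf q.+1 u Xf_one_critical) => [|sM]; [by left | right].
  by apply: (stalls_image (f := fun A => (d @: (p @: A))%VS)) sM; rewrite !limg0.
pose R := std_resolution (persistent_homology Xf q).
split=> [i u _|u|u] xi_neq0.
- case: (sB u) => [|sBu]; [by left | case: (sZ u) => [|sZu]; [by right | exfalso]].
  by apply: xi_neq0; apply: (Tor_pres R Zmono BZ pr_onto pr_eq0 pr_act).
- case: (sZ u) => // sZu; case: xi_neq0.
  exact: (Tor_0_pres R pr_onto pr_act).
case: (sB u) => // sBu; case: xi_neq0.
exact: (Tor_n_pres R Zmono pr_onto pr_eq0 pr_act n_ge1).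
Qed.
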